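(* Let a multi-affine function $f(z_0,z)\in\mathcal{IP}_{d+1}^{m\times m}$ be represented as $$f(z_0,z)=\frac{P(z_0,z)}{q(z_0,z)}=\frac{z_0P_1(z)+P_2(z)}{z_0q_1(z)+q_2(z)},\qquad z\in\mathbb{C}^d,$$ where $q$ is a scalar polynomial with real coefficients, $P$ is a matrix polynomial whose coefficients are Hermitian $m\times m$ matrices, and both have degree at most $1$ in each variable. Let $$W_{z_0}[q,P]=P_1(z)q_2(z)-P_2(z)q_1(z)=\Phi_0(z)\Phi_0(\overline z)^{*}$$ be an SOS polynomial, where $\Phi_0$ is a matrix polynomial of size $m\times r$. Then: (i) If $q_1(z)\not\equiv 0$, then $$g(z)=\begin{pmatrix}g_{11}(z)&g_{12}(z)\\ g_{21}(z)&g_{22}(z)\end{pmatrix}=\frac{1}{q_1(z)}\begin{pmatrix}P_1(z)&\Phi_0(z)\\ \Phi_0(\overline z)^{*}&q_2(z)I_r\end{pmatrix}$$ is a multi-affine function of class $\mathcal{IP}_d^{(m+r)\times(m+r)}$ and $$f(z_0,z)=g_{11}(z)-g_{12}(z)(g_{22}(z)+z_0I_r)^{-1}g_{21}(z).$$ (ii) If $q_2(z)\not\equiv 0$, then $$g(z)=\begin{pmatrix}g_{11}(z)&g_{12}(z)\\ g_{21}(z)&g_{22}(z)\end{pmatrix}=\frac{1}{q_2(z)}\begin{pmatrix}P_2(z)&\Phi_0(z)\\ \Phi_0(\overline z)^{*}&-q_1(z)I_r\end{pmatrix}$$ is a multi-affine function of class $\mathcal{IP}_d^{(m+r)\times(m+r)}$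 and $$f(z_0,z)=g_{11}(z)-g_{12}(z)(g_{22}(z)-z_0^{-1}I_r)^{-1}g_{21}(z).$$
   Context: $\Pi^d=\{z\in\mathbb{C}^d\mid \mathrm{Im}\,z_1>0,\ldots,\mathrm{Im}\,z_d>0\}$. The Pick class $\mathcal{P}_d^{m\times m}$ consists of the $\mathbb{C}^{m\times m}$-valued functions $f$ of $d$ variables holomorphic in $\Pi^d$ with $(f(z)-f(z)^{*})/2i\ge 0$ (positive semidefinite) for $z\in\Pi^d$; $^{*}$ is the Hermitian conjugate. $\mathcal{IP}_d^{m\times m}$ is the subclass of rational functions in $\mathcal{P}_d^{m\times m}$ that are Cayley inner, i.e. take Hermitian matrix values almost everywhere on $\mathbb{R}^d$. A rational function $P/q$ is multi-affine if $P$ and $q$ have degree at most $1$ in each variable. $P_1,P_2,q_1,q_2$ are polynomials in $z=(z_1,\ldots,z_d)$ only; $\overline z=(\overline z_1,\ldots,\overline z_d)$; $I_r$ is the $r\times r$ identity matrix. A $\mathbb{C}^{m\times m}$-valued polynomial $F(z)$ is a sum of squares (SOS) if $F(z)=H(z)H(\overline z)^{*}$ for some $\mathbb{C}^{m\times k}$-valued polynomial $H$.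
   Formalization: The representation P/q is assumed to have q ≠ 0 throughout Π^{d+1} (automatic in lowest terms); with arbitrary common factors the claim fails: d=m=r=1, P=q=z_0−z_1, f=1, Φ_0=0 gives g=diag(1,−z_1), not in the Pick class. *)

(* Defs.v *)
From HB Require Import structures.
From mathcomp Require Import all_boot all_order all_algebra.
From mathcomp Require Import complex.
From mathcomp Require mpoly.
(* The notations of mpoly clash with those of mathcomp-analysis. *)
Export (canonicals, coercions) mpoly.
From mathcomp Require Import all_classical all_reals all_analysis.

Set Implicit Arguments.
Unset Strict Implicit.
Unset Printing Implicit Defensive.

Import Order.TTheory GRing.Theory Num.Theory.
Import numFieldNormedType.Exports.

Local Open Scope classical_set_scope.
Local Open Scope ring_scope.
Local Open Scope sesquilinear_scope.

(* Going through [numClosedFieldType] is what gives R[i] the norm and topology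
   of numFieldNormedType; no such instance is keyed on [complex] itself. *)
Definition Cplx (R : realType) : numClosedFieldType := R[i].

Notation mpoly C n := (mpoly.mpoly n C).

Section Polynomials.
Variable C : numClosedFieldType.

Definition pteval n (p : mpoly C n) (z : 'rV[C]_n) : C :=
  mpoly.meval (fun i => z ord0 i) p.

Definition mxeval n m k (P : 'M[mpoly C n]_(m, k)) (z : 'rV[C]_n) :
  'M[C]_(m, k) := map_mx (fun p => pteval p z) P.

Definition multiaffine n (p : mpoly C n) : Prop :=
  forall a, mpoly.mcoeff a p != 0 -> forall i : 'I_n, (a i <= 1)%N.

Definition multiaffine_mx n m k (P : 'M[mpoly C n]_(m, k)) : Prop :=
  forall i j, multiaffine (P i j).

Definition real_coefs n (p : mpoly C n) : Prop :=
  forall a, mpoly.mcoeff a p \is Num.real.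

Definition hermitian_coefs n m (P : 'M[mpoly C n]_m) : Prop :=
  forall a, map_mx (mpoly.mcoeff a) P \is hermsymmx.

Definition conjpt n (z : 'rV[C]_n) : 'rV[C]_n := map_mx Num.conj z.

Definition is_sos_factor n m r (F : 'M[mpoly C n]_m)
    (H : 'M[mpoly C n]_(m, r)) : Prop :=
  forall z, mxeval F z = mxeval H z *m (mxeval H (conjpt z)) ^t*.

Definition wronskian n m (P1 P2 : 'M[mpoly C n]_m) (q1 q2 : mpoly C n) :
  'M[mpoly C n]_m := q2 *: P1 - q1 *: P2.

Definition psd m (A : 'M[C]_m) : Prop :=
  A \is hermsymmx /\ forall v : 'rV[C]_m, 0 <= (v *m A *m v ^t*) ord0 ord0.

Definition upper_half n : set 'rV[C]_n :=
  [set z | forall i, 0 < 'Im (z ord0 i)].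

(* A rational function is a total function whose values at the zeros of the
   denominator are left unspecified. *)
Definition represented_by n m (f : 'rV[C]_n -> 'M[C]_m)
    (P : 'M[mpoly C n]_m) (q : mpoly C n) : Prop :=
  q != 0 /\
  forall z, pteval q z != 0 -> f z = (pteval q z)^-1 *: mxeval P z.

Definition rational_fun n m (f : 'rV[C]_n -> 'M[C]_m) : Prop :=
  exists P q, represented_by f P q.

Definition multiaffine_fun n m (f : 'rV[C]_n -> 'M[C]_m) : Prop :=
  exists P q, [/\ represented_by f P q, multiaffine_mx P & multiaffine q].

Definition holomorphic_on n m (D : set 'rV[C]_n)
    (f : 'rV[C]_n -> 'M[C]_m) : Prop :=
  forall z, D z -> differentiable f z.

Definition pick_class n m (f : 'rV[C]_n -> 'M[C]_m) : Prop :=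
  holomorphic_on (@upper_half n) f /\
  forall z, upper_half z -> psd ((2 * 'i)^-1 *: (f z - (f z) ^t*)).

(* (1 / q(z)) [[P(z), Phi(z)], [Phi(conj z)^*, s(z) I_r]] *)
Definition bordered n m r (q : mpoly C n) (P : 'M[mpoly C n]_m)
    (Phi : 'M[mpoly C n]_(m, r)) (s : mpoly C n) (z : 'rV[C]_n) :
    'M[C]_(m + r) :=
  (pteval q z)^-1 *:
    block_mx (mxeval P z) (mxeval Phi z)
             ((mxeval Phi (conjpt z)) ^t*) (pteval s z)%:M.

End Polynomials.

(* Lebesgue null sets of R^n, by countable covers with closed boxes of small
   total volume. The index set K lets the empty cover be used, which matters
   only for n = 0, where every box has volume 1. *)
Definition null_set (R : realType) n (A : set 'rV[R]_n) : Prop :=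
  forall e : R, 0 < e ->
  exists (K : set nat) (a b : nat -> 'rV[R]_n),
    [/\ forall k i, a k ord0 i <= b k ord0 i,
        A `<=` \bigcup_(k in K)
                 [set x | forall i, a k ord0 i <= x ord0 i <= b k ord0 i] &
        (\esum_(k in K) (\prod_(i < n) (b k ord0 i - a k ord0 i))%:E
           <= e%:E)%E].

Definition real_pt (R : realType) n (x : 'rV[R]_n) : 'rV[Cplx R]_n :=
  map_mx (real_complex R) x.

Definition cayley_inner (R : realType) n m
    (f : 'rV[Cplx R]_n -> 'M[Cplx R]_m) : Prop :=
  null_set [set x | f (real_pt x) \isn't hermsymmx].

Definition IP_class (R : realType) n m
    (f : 'rV[Cplx R]_n -> 'M[Cplx R]_m) : Prop :=
  [/\ pick_class f, rational_fun f & cayley_inner f].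

(* Main.v *)
Require Import Defs.
From mathcomp Require Import all_boot all_order all_algebra.
From mathcomp Require Import complex ring lra.
From mathcomp Require Import all_classical all_reals all_analysis.
Set Implicit Arguments.
Unset Strict Implicit.
Unset Printing Implicit Defensive.
Import Order.TTheory GRing.Theory Num.Theory.
Import numFieldNormedType.Exports.
Local Open Scope classical_set_scope.
Local Open Scope ring_scope.
Local Open Scope sesquilinear_scope.

(** The substitution z0 -> - 1 / z0 preserves the upper
    half-plane and replaces (P1, P2, q1, q2) by (P2, - P1, q2, - q1) without
    changing W, so that case (ii) is case (i) for these data. The realization
    formula is the identity P1 (z0 q1 + q2) - W = q1 (z0 P1 + P2), divided by q1 and
    by q ([bordered_schur]).

    The substance is the positivity of Im g. At a single point the hypotheses on f
    bear only on the product W of the off-diagonal blocks of G = q1 g, so the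
    inequality cannot be obtained pointwise. It is propagated from the real points,
    where g is Hermitian, into the product of half-planes, one variable t at a time
    ([bordered_form_ge0]). With the other variables fixed, the form of g at a vector
    u is a quotient (ga t + de) / (al t + be), and the imaginary part of the
    numerator times the conjugate of the denominator is, at t = x + i y,

        Q(x) + y Re h + y^2 K,      h = ga conj(be) - de conj(al),

    where Q >= 0 is a real quadratic with leading coefficient K >= 0. Thus
    everything comes down to Re h >= 0. If the pole is strictly below the real line,
    this results from evaluating at the pole ([wronsk_ge0_pole_below]). If the pole
    is real or infinite, h is the form at u of a matrix H. It is Hermitian, since
    the square of Im h is then the discriminant of Q ([wronsk_real]). Its diagonal
    blocks H11 and eta I are nonnegative, since g11 = P1 / q1 is the limit of f as
    z0 tends to i times infinity, and g22 = q2 / q1 has nonnegative imaginary part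
    because z0 q1 + q2 has no zero in the upper half-planes ([wronsk_ge0]). Finally,
    W = Phi0(z) Phi0(conj z)^H taken at the root of q1 reads eta H11 = H12 H21. A
    Hermitian block matrix with these properties is positive semidefinite
    ([block_form_ge0]).

    Three facts complete the proof. The denominator q1 has no zero in the product of
    upper half-planes ([stable_head_neq0]). The factor Phi0 is multi-affine, because
    on real points the diagonal of W is a sum of squared moduli of its entries and
    has degree at most 2 in each variable ([sos_sepaff]). The real zeros of q1 form
    a null set, because zeros with a nonzero slope in some variable lie on countably
    many Lipschitz graphs ([poly_zero_null]). *)

Local Notation null_set := Defs.null_set.

(** * Real and imaginary parts, and quadratic inequalities *)

Section ComplexParts.
Variable R : realType.
Local Notation C := (Cplx R).
Implicit Types (z w : C) (a b : R).

Definition re z : R := complex.Re z.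
Definition im z : R := complex.Im z.
Definition inC a : C := real_complex R a.

Lemma reD z w : re (z + w) = re z + re w. Proof. by case: z w => [? ?] []. Qed.
Lemma imD z w : im (z + w) = im z + im w. Proof. by case: z w => [? ?] []. Qed.
Lemma reN z : re (- z) = - re z. Proof. by case: z. Qed.
Lemma imN z : im (- z) = - im z. Proof. by case: z. Qed.
Lemma reM z w : re (z * w) = re z * re w - im z * im w.
Proof. by case: z w => [? ?] []. Qed.
Lemma imM z w : im (z * w) = re z * im w + im z * re w.
Proof. by case: z w => [? ?] []. Qed.
Lemma reJ z : re z^* = re z. Proof. by case: z. Qed.
Lemma imJ z : im z^* = - im z. Proof. by case: z. Qed.
Lemma re_inC a : re (inC a) = a. Proof. by []. Qed.
Lemma im_inC a : im (inC a) = 0. Proof. by []. Qed.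
Lemma re0 : re 0 = 0. Proof. by []. Qed.
Lemma im0 : im 0 = 0. Proof. by []. Qed.
Lemma re1 : re 1 = 1. Proof. by []. Qed.
Lemma im1 : im 1 = 0. Proof. by []. Qed.
Lemma re_i : re 'i = 0.
Proof. by []. Qed.
Lemma im_i : im 'i = 1.
Proof. by []. Qed.

Definition cE := (reD, imD, reN, imN, reM, imM, reJ, imJ, re_inC, im_inC,
  re0, im0, re1, im1, re_i, im_i).

Lemma complex_ext z w : re z = re w -> im z = im w -> z = w.
Proof. by case: z w => [a b] [c d]; rewrite /re /im /= => -> ->. Qed.

Lemma ImE_inC z : 'Im z = inC (im z).
Proof.
have -> : z = inC (re z) + 'i * inC (im z).
  by apply: complex_ext; rewrite !cE; ring.
by rewrite Im_rect ?complex_real ?eqxx // !cE; congr inC; ring.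
Qed.

Lemma im_gt0 z : (0 < 'Im z) = (0 < im z).
Proof. by rewrite ImE_inC ltcR. Qed.

Lemma normsq_gt0 z : z != 0 -> 0 < re z ^+ 2 + im z ^+ 2.
Proof.
move=> z0; rewrite lt_neqAle addr_ge0 ?sqr_ge0 // andbT eq_sym.
apply: contraNneq z0 => /eqP; rewrite paddr_eq0 ?sqr_ge0 // !sqrf_eq0.
by move=> /andP[/eqP h1 /eqP h2]; apply/eqP/complex_ext.
Qed.

Lemma quad_ge0 (K L J : R) : (forall x, 0 <= K * x ^+ 2 + L * x + J) ->
  [/\ 0 <= K, 0 <= J & L ^+ 2 <= 4 * K * J].
Proof.
move=> h.
have J0 : 0 <= J by have := h 0; rewrite !expr2; lra.
have K0 : 0 <= K.
  rewrite leNgt; apply/negP => K0.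
  pose M := J / (- K) + 1.
  have M1 : 1 <= M by rewrite /M lerDr divr_ge0 //; lra.
  have MK : M * (- K) = J - K by rewrite /M; field; lra.
  have := h M; have := h (- M); nra.
split=> //.
have [K1|K1] := eqVneq K 0; last first.
  have := h (- L / (2 * K)).
  have Kp : 0 < K by rewrite lt_neqAle eq_sym K1.
  move=> /(mulr_ge0 (ltW Kp)).
  have -> : K * (K * (- L / (2 * K)) ^+ 2 + L * (- L / (2 * K)) + J)
     = K * J - L ^+ 2 / 4 by field.
  lra.
subst K; suff -> : L = 0 by rewrite expr2; lra.
apply/eqP/negPn/negP => L0; have := h (- (J + 1) / L).
have -> : 0 * (- (J + 1) / L) ^+ 2 + L * (- (J + 1) / L) + J = -1 by field.
lra.
Qed.

(** This stands for every passage to the boundary below: the quantities whose sign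
    is wanted there are quadratic in the distance [y] to it. *)
Lemma quad_at0_ge0 (J L K : R) :
  (forall y, 0 < y -> y <= 1 -> 0 <= J + L * y + K * y ^+ 2) -> 0 <= J.
Proof.
move=> h; rewrite leNgt; apply/negP => J0.
pose M := `|L| + `|K| - J.
have M0 : 0 < M by rewrite /M; have := normr_ge0 L; have := normr_ge0 K; lra.
pose y := - J / (M + M).
have yM : y * M = - J / 2 by rewrite /y; field; lra.
have y0 : 0 < y by rewrite /y divr_gt0 //; lra.
have y1 : y <= 1.
  by rewrite ler_pdivrMr; have := normr_ge0 L; have := normr_ge0 K; rewrite /M; lra.
have := h y y0 y1; have := ler_norm L; have := ler_norm K.
have : y ^+ 2 <= y by rewrite expr2; nra.
have := normr_ge0 K; have := normr_ge0 L; rewrite /M in yM *; nra.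
Qed.

(** * Quotients of two affine functions of one complex variable *)

(** The sign of the imaginary part of (ga t + de) / (al t + be) is that of [E t],
    which remains meaningful at the pole. On the real line [E] is the quadratic
    K x^2 + L x + J; above it the new ingredient is [h], a Wronskian of numerator
    and denominator with one factor of each product conjugated. *)
Section AffineFraction.
Variables (ga de al be : C).
Let E t := im ((t * ga + de) * (t * al + be)^*).
Let K := im (ga * al^*).
Let L := im (ga * be^*) + im (de * al^*).
Let J := im (de * be^*).
Let h := ga * be^* - de * al^*.
Hypothesis cross_real : forall x : R, 0 <= E (inC x).

Lemma cross_expand t : E t = K * re t ^+ 2 + L * re t + J + im t * re h + im t ^+ 2 * K.
Proof. by rewrite /E /K /L /J /h !cE; ring. Qed.

Lemma cross_quad : [/\ 0 <= K, 0 <= J & L ^+ 2 <= 4 * K * J].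
Proof.
apply: quad_ge0 => x; have := cross_real x; rewrite cross_expand re_inC im_inC.
by rewrite !mul0r expr0n /= mul0r !addr0.
Qed.

(** Above the real line [E] gains y (Re h + y K), and K >= 0 is the leading
    coefficient of a nonnegative quadratic. *)
Lemma cross_ge0 t : 0 <= re h -> 0 <= im t -> 0 <= E t.
Proof.
move=> h0 t0; rewrite cross_expand; have [K0 _ _] := cross_quad.
have := cross_real (re t); rewrite cross_expand re_inC im_inC expr0n /= !mul0r !addr0 => Q.
by apply: addr_ge0; [apply: addr_ge0 => //|]; rewrite mulr_ge0 ?sqr_ge0.
Qed.

(** [E] vanishes at the pole x0 - i b, so that b Re h = Q(x0) + b^2 K, where Q is
    the quadratic on the real line. *)
Lemma wronsk_ge0_pole_below : 0 < im (be * al^*) -> 0 <= re h.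
Proof.
move=> b0; set b := im _ in b0.
have al0 : al != 0 by apply: contraTneq b0 => al0; rewrite /b al0 !cE; lra.
have := normsq_gt0 al0; set n := _ + _ => n0; set r := re (be * al^*).
(* The pole - be / al is (- r - i b) / n. *)
have [K0 _ _] := cross_quad.
have := cross_real (- r / n); rewrite cross_expand re_inC im_inC.
move=> /(mulr_ge0 (sqr_ge0 n)).
have -> : n ^+ 2 * (K * (- r / n) ^+ 2 + L * (- r / n) + J + 0 * re h + 0 ^+ 2 * K)
  = K * r ^+ 2 - L * r * n + J * n ^+ 2 by field; rewrite gt_eqF.
have -> : K * r ^+ 2 - L * r * n + J * n ^+ 2 = re h * (b * n) - b ^+ 2 * K.
  by rewrite /K /L /J /h /b /n /r !cE; ring.
move=> H; have bn : 0 < b * n by rewrite mulr_gt0.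
by rewrite -(pmulr_lge0 _ bn); have := mulr_ge0 (sqr_ge0 b) K0; lra.
Qed.

Hypothesis b0 : im (be * al^*) = 0.

(** A Pluecker relation between the vectors ga, de and al, be of the plane. *)
Let discr : im h ^+ 2 = L ^+ 2 - 4 * K * J.
Proof.
have -> : im h ^+ 2 = L ^+ 2 - 4 * K * J + 4 * im (be * al^*) * im (de * ga^*).
  by rewrite /K /L /J /h !cE; ring.
by rewrite b0; ring.
Qed.

(** With a pole on the extended real line, the square of Im h is the discriminant
    of a nonnegative quadratic. *)
Lemma wronsk_real : im h = 0.
Proof.
apply/eqP; rewrite -sqrf_eq0; have [_ _ H] := cross_quad.
by rewrite eq_le sqr_ge0 andbT discr; lra.
Qed.

(** If K > 0, then [E] vanishes at the double root of the quadratic and grows from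
    there at the rate Re h; if K = 0, then Re h is the slope of [E] at infinity. *)
Lemma wronsk_ge0 : (forall t, 0 <= im t -> 0 <= E t) -> 0 <= re h.
Proof.
move=> Epos; have [K0 J0 LL] := cross_quad.
have := discr; rewrite wronsk_real expr0n /= => D.
have [K1|K1] := eqVneq K 0; last first.
  apply: (@quad_at0_ge0 _ K 0) => y y0 _.
  have := Epos (Complex (- L / (2 * K)) y) (ltW y0).
  rewrite cross_expand.
  have -> : re (Complex (- L / (2 * K)) y) = - L / (2 * K) by [].
  have -> : im (Complex (- L / (2 * K)) y) = y by [].
  have -> : K * (- L / (2 * K)) ^+ 2 + L * (- L / (2 * K)) + J
    + y * re h + y ^+ 2 * K = - (L ^+ 2 - 4 * K * J) / (4 * K) + y * (re h + K * y).
    by field.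
  by rewrite -D oppr0 mul0r add0r pmulr_rge0 // mul0r addr0.
have L0 : L = 0 by move: D; rewrite K1 => D; apply/eqP; rewrite -sqrf_eq0; lra.
apply: (@quad_at0_ge0 _ J 0) => y y0 _.
have := Epos (Complex 0 y^-1); rewrite cross_expand.
have -> : re (Complex 0 y^-1) = 0 by [].
have -> : im (Complex 0 y^-1) = y^-1 by [].
rewrite K1 L0 => /(_ _)/(mulr_ge0 (ltW y0)); rewrite invr_ge0 => /(_ (ltW y0)).
have -> : y * (0 * 0 ^+ 2 + 0 * 0 + J + y^-1 * re h + y^-1 ^+ 2 * 0) = re h + J * y.
  by field; lra.
by rewrite mul0r addr0.
Qed.

End AffineFraction.
End ComplexParts.

(** * Hermitian forms of block matrices *)

Section Block.
Variable R : realType.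
Local Notation C := (Cplx R).

Definition hform n (v : 'rV[C]_n) (A : 'M[C]_n) : C := (v *m A *m v ^t*) ord0 ord0.

Lemma ge0_re_im (z : C) : 0 <= z -> 0 <= re z /\ im z = 0.
Proof. by rewrite lecE => /andP[/eqP h1 h2]; split. Qed.

Lemma rowsq_ge0 n (x : 'rV[C]_n) : 0 <= (x *m x ^t*) ord0 ord0.
Proof.
by rewrite mxE sumr_ge0 // => j _; rewrite !mxE -normCK exprn_ge0.
Qed.

Lemma rowsq_eq0 n (x : 'rV[C]_n) : (x *m x ^t*) ord0 ord0 = 0 -> x = 0.
Proof.
rewrite mxE => /eqP.
rewrite psumr_eq0; last by move=> j _; rewrite !mxE -normCK exprn_ge0.
move=> /allP h; apply/rowP => j; have := h j (mem_index_enum _).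
by rewrite !mxE -normCK sqrf_eq0 normr_eq0 => /eqP.
Qed.

Lemma hform_block m r (v : 'rV[C]_m) (w : 'rV[C]_r) A B D (e : C) :
  hform (row_mx v w) (block_mx A B D e%:M) =
  hform v A + (v *m B *m w ^t*) ord0 ord0 + (w *m D *m v ^t*) ord0 ord0
  + e * (w *m w ^t*) ord0 ord0.
Proof.
rewrite /hform mul_row_block tr_row_mx map_col_mx mul_row_col !mulmxDl.
rewrite mul_mx_scalar -scalemxAl !mxE.
ring.
Qed.

Lemma hform_lin n (v : 'rV[C]_n) (k : C) (A B : 'M[C]_n) :
  hform v (k *: A + B) = k * hform v A + hform v B.
Proof. by rewrite /hform mulmxDr mulmxDl -scalemxAr -scalemxAl !mxE. Qed.

Lemma hformZ n (v : 'rV[C]_n) (k : C) (A : 'M[C]_n) :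
  hform v (k *: A) = k * hform v A.
Proof. by rewrite /hform -scalemxAr -scalemxAl mxE. Qed.

Lemma hformB n (v : 'rV[C]_n) (A B : 'M[C]_n) :
  hform v (A - B) = hform v A - hform v B.
Proof. by rewrite /hform mulmxBr mulmxBl !mxE. Qed.

Lemma rowsq_addZ n (x w : 'rV[C]_n) (e : C) :
  ((x + e *: w) *m (x + e *: w) ^t*) ord0 ord0 =
  (x *m x ^t*) ord0 ord0 + e^* * (x *m w ^t*) ord0 ord0
  + e * (w *m x ^t*) ord0 ord0 + e * e^* * (w *m w ^t*) ord0 ord0.
Proof.
have -> : (x + e *: w) ^t* = x ^t* + e^* *: w ^t*.
  by apply/matrixP => i j; rewrite !mxE rmorphD rmorphM.
rewrite !mulmxDl !mulmxDr -!(scalemxAl, scalemxAr) !mxE.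
by ring.
Qed.

(** The hypothesis e A = B D says that the Schur complement of e I vanishes. If
    e > 0, the form is the square |v B + e w|^2 divided by e. If e = 0, then
    B B^H = 0, hence B = 0 and only A is left. *)
Lemma block_form_ge0 m r (A : 'M[C]_m) (B : 'M[C]_(m, r)) (D : 'M[C]_(r, m))
    (e : C) :
  (forall u, im (hform u (block_mx A B D e%:M)) = 0) ->
  (forall v, 0 <= re (hform v A)) -> 0 <= re e -> im e = 0 ->
  e *: A = B *m D ->
  forall u, 0 <= re (hform u (block_mx A B D e%:M)).
Proof.
move=> herm A0 re0 ie0 eA u.
have sclE k (X : 'M[C]_1) : (k *: X) ord0 ord0 = k * X ord0 ord0 by rewrite mxE.
have sesq (k : C) n (w : 'rV[C]_n) : (k *: w) ^t* = k^* *: w ^t*.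
  by apply/matrixP => i j; rewrite !mxE rmorphM.
have zero n : (0 : 'rV[C]_n) ^t* = 0 by apply/matrixP=> i j; rewrite !mxE rmorph0.
have imA (v : 'rV[C]_m) : im (hform v A) = 0.
  have := herm (row_mx v 0); rewrite hform_block zero !mulmx0 mul0mx mul0mx !mxE.
  by rewrite !mulr0 !addr0.
have imw (w : 'rV[C]_r) : im ((w *m w ^t*) ord0 ord0) = 0.
  by case: (ge0_re_im (rowsq_ge0 w)).
have sym (v : 'rV[C]_m) (w : 'rV[C]_r) :
    (w *m D *m v ^t*) ord0 ord0 = ((v *m B *m w ^t*) ord0 ord0)^*.
  (* The imaginary part of the form at (v, w) fixes the imaginary parts of the
     cross terms, its value at (v, i w) their real parts. *)
  have h1 := herm (row_mx v w); have h2 := herm (row_mx v ('i *: w)).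
  move: h1 h2; rewrite !hform_block !sesq -!(scalemxAl, scalemxAr) !sclE.
  have := imA v; have := imw w; move: (hform v A) => a.
  move: ((v *m B *m w ^t*) _ _) ((w *m D *m v ^t*) _ _) ((w *m w ^t*) _ _).
  move=> p p' s s0 a0.
  rewrite !cE a0 s0 ie0 !(mul0r, mul1r, mulr0, oppr0, subr0, add0r, addr0) => h1 h2.
  by apply: complex_ext; rewrite !cE; lra.
have DvE (v : 'rV[C]_m) : D *m v ^t* = (v *m B) ^t*.
  apply/matrixP => j k; rewrite (ord1 k).
  have := sym v (delta_mx ord0 j); rewrite -mulmxA -rowE mxE => ->.
  rewrite [in RHS]mxE [in RHS]mxE; congr (_ ^*).
  suff -> : (delta_mx ord0 j : 'rV[C]_r) ^t* = delta_mx j ord0 by rewrite -colE mxE.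
  by apply/matrixP=> a b; rewrite !mxE conjC_nat andbC.
have key (v : 'rV[C]_m) : e * hform v A = (v *m B *m (v *m B) ^t*) ord0 ord0.
  by rewrite -DvE mulmxA -(mulmxA v) -eA /hform -scalemxAr -scalemxAl !mxE.
rewrite -[u]hsubmxK hform_block sym.
set v : 'rV_m := lsubmx u; set w : 'rV_r := rsubmx u.
have [ee|ee] := eqVneq (re e) 0.
  have e0 : e = 0 by apply: complex_ext; rewrite !cE.
  have /rowsq_eq0 -> : (v *m B *m (v *m B) ^t*) ord0 ord0 = 0 by rewrite -key e0 mul0r.
  by rewrite mul0mx mxE e0 mul0r !cE !addr0 A0.
have ep : 0 < re e by rewrite lt_neqAle eq_sym ee.
have wB : (w *m (v *m B) ^t*) ord0 ord0 = ((v *m B *m w ^t*) ord0 ord0)^*.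
  by rewrite -sym -DvE mulmxA.
(* Multiplied by e, the form is the squared norm of v B + e w. *)
have [+ _] := ge0_re_im (rowsq_ge0 (v *m B + e *: w)).
rewrite rowsq_addZ wB -key => H; rewrite -(pmulr_rge0 _ ep); move: H.
have := imA v; have := imw w; move: (hform v A) => a.
move: ((v *m B *m w ^t*) _ _) ((w *m w ^t*) _ _) => p s s0 a0.
rewrite !cE a0 s0 ie0 => H; apply: le_trans H _.
by rewrite le_eqVlt; apply/orP; left; apply/eqP; ring.
Qed.
End Block.

(** * Changing one coordinate at a time *)

Section Coordinates.
Variables (T : Type) (n : nat).
Implicit Types (z : 'rV[T]_n) (k : 'I_n) (t : T).

Definition upd z k t : 'rV[T]_n := \row_i (if i == k then t else z ord0 i).

Lemma updE z k t i : upd z k t ord0 i = if i == k then t else z ord0 i.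
Proof. by rewrite mxE. Qed.

Lemma upd_id z k : upd z k (z ord0 k) = z.
Proof. by apply/rowP => i; rewrite mxE; case: eqP => [->|]. Qed.

Lemma upd_upd z k s t : upd (upd z k s) k t = upd z k t.
Proof. by apply/rowP => i; rewrite !mxE; case: eqP. Qed.

Lemma updC z k l s t : k != l -> upd (upd z k s) l t = upd (upd z l t) k s.
Proof.
move=> kl; apply/rowP => i; rewrite !mxE.
by have [->|//] := eqVneq i l; rewrite eq_sym (negbTE kl).
Qed.

(** A property is carried from one product of domains to another by replacing the
    domain of one coordinate at a time; at each stage every coordinate lies in one
    of its two domains. *)
Lemma coordwise_ind (D D' : 'I_n -> T -> Prop) (P : 'rV[T]_n -> Prop) :
  (forall z, (forall i, D i (z ord0 i)) -> P z) ->
  (forall z k, (forall i, D i (z ord0 i) \/ D' i (z ord0 i)) ->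
     (forall t, D k t -> P (upd z k t)) -> D' k (z ord0 k) -> P z) ->
  forall z, (forall i, D' i (z ord0 i)) -> P z.
Proof.
move=> base step.
suff H (s : seq 'I_n) : forall z, (forall i, i \in s -> D' i (z ord0 i)) ->
    (forall i, i \notin s -> D i (z ord0 i)) -> P z.
  by move=> z zD; apply: (H (enum 'I_n)) => // i; rewrite mem_enum.
elim: s => [|k s IH] z zD' zD; first by apply: base => i; apply: zD.
have [ks|ks] := boolP (k \in s).
  apply: IH => i; first by move=> iS; apply: zD'; rewrite inE iS orbT.
  move=> iS; apply: zD; rewrite inE negb_or iS andbT.
  by apply: contraNneq iS => ->.
apply: (step z k).
- by move=> i; have [/zD'|/zD] := boolP (i \in k :: s); [right|left].
- move=> t tD; apply: IH => i iS; rewrite updE; case: eqP => [ik|/eqP ik].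
  + by rewrite -ik iS in ks.
  + by apply: zD'; rewrite inE iS orbT.
  + by rewrite ik.
  + by apply: zD; rewrite inE negb_or ik.
- by apply: zD'; rewrite inE eqxx.
Qed.

End Coordinates.

(** * Separately affine functions *)

Section Sepaff.
Variables (C : numClosedFieldType) (n : nat).
Implicit Types (F G : 'rV[C]_n -> C) (z : 'rV[C]_n).

(** Being multi-affine, for a function: the slope and the constant term in each
    variable are read off at 1 and 0, so that no coefficients are involved. *)
Definition sepaff F := forall k z t,
  F (upd z k t) = t * (F (upd z k 1) - F (upd z k 0)) + F (upd z k 0).

Lemma sepaff_ext F G : F =1 G -> sepaff F -> sepaff G.
Proof. by move=> e h k z t; rewrite -!e. Qed.

Lemma sepaffD F G : sepaff F -> sepaff G -> sepaff (fun z => F z + G z).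
Proof. by move=> f g k z t; rewrite f g; ring. Qed.

Lemma sepaffB F G : sepaff F -> sepaff G -> sepaff (fun z => F z - G z).
Proof. by move=> f g k z t; rewrite f g; ring. Qed.

Lemma sepaffZ c F : sepaff F -> sepaff (fun z => c * F z).
Proof. by move=> f k z t; rewrite f; ring. Qed.

Lemma sepaff_cst (c : C) : sepaff (fun=> c).
Proof. by move=> k z t; ring. Qed.

Lemma sepaff_sum (I : Type) (s : seq I) (Q : pred I) (F : I -> 'rV[C]_n -> C) :
  (forall i, Q i -> sepaff (F i)) -> sepaff (fun z => \sum_(i <- s | Q i) F i z).
Proof.
move=> h; elim: s => [|i s IH].
  by apply: sepaff_ext (sepaff_cst 0) => z; rewrite big_nil.
case Qi : (Q i).
  by apply: sepaff_ext (sepaffD (h i Qi) IH) => z; rewrite big_cons Qi.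
by apply: sepaff_ext IH => z; rewrite big_cons Qi.
Qed.

Lemma sepaff_upd F j c : sepaff F -> sepaff (fun z => F (upd z j c)).
Proof.
move=> f k z t; have [->|kj] := eqVneq k j.
  by rewrite !upd_upd subrr mulr0 add0r.
by rewrite !(updC z _ _ kj).
Qed.

Definition mxsepaff m p (A : 'rV[C]_n -> 'M[C]_(m, p)) :=
  forall i j, sepaff (fun z => A z i j).

Lemma mxsepaffE m p (A : 'rV[C]_n -> 'M[C]_(m, p)) k z t : mxsepaff A ->
  A (upd z k t) = t *: (A (upd z k 1) - A (upd z k 0)) + A (upd z k 0).
Proof. by move=> h; apply/matrixP=> i j; rewrite h !mxE. Qed.

End Sepaff.

(** * Positivity of the bordered matrix *)

Section PickCore.
Variable R : realType.
Local Notation C := (Cplx R).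
Implicit Types n : nat.

Lemma sepaff_hform n m (A : 'rV[C]_n -> 'M[C]_m) v :
  mxsepaff A -> sepaff (fun z => hform v (A z)).
Proof.
by move=> h k z t; rewrite (mxsepaffE _ _ _ h) hform_lin hformB.
Qed.

Lemma im_mulJ (x q : C) : q != 0 ->
  im (x * q^*) = (re q ^+ 2 + im q ^+ 2) * im (q^-1 * x).
Proof.
move=> q0; have -> : x * q^* = inC (re q ^+ 2 + im q ^+ 2) * (q^-1 * x).
  have <- : q * q^* = inC (re q ^+ 2 + im q ^+ 2).
    by apply: complex_ext; rewrite !cE; ring.
  by rewrite -mulrA mulrCA mulrA -mulrA mulVKf // mulrC.
by rewrite imM re_inC im_inC mul0r addr0.
Qed.

Lemma im_root_gt0 (al be : C) : im (be * al^*) < 0 -> 0 < im (- be / al).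
Proof.
move=> neg; have al0 : al != 0.
  by apply: contraTneq neg => ->; rewrite !cE; lra.
move: neg; rewrite im_mulJ // pmulr_rlt0 ?normsq_gt0 //.
by rewrite mulNr imN oppr_gt0 mulrC.
Qed.

(** Moving one coordinate from the real line into the upper half-plane makes the
    expression quadratic in the height. *)
Lemma im_ge0_closure n (F G : 'rV[C]_n -> C) : sepaff F -> sepaff G ->
  (forall z : 'rV[C]_n, (forall i, 0 < im (z ord0 i)) -> 0 <= im (F z * (G z)^*)) ->
  forall z : 'rV[C]_n, (forall i, 0 <= im (z ord0 i)) -> 0 <= im (F z * (G z)^*).
Proof.
move=> sF sG H z.
apply: (coordwise_ind (D := fun _ t => 0 < im t) (D' := fun _ t => 0 <= im t)
  (P := fun z => 0 <= im (F z * (G z)^*))) => // {}z k _ hk zk.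
set f := F (upd z k 1) - F (upd z k 0); set g := G (upd z k 1) - G (upd z k 0).
pose f' := 'i * f : C; pose g' := 'i * g : C.
have Fy y : F (upd z k (z ord0 k + 'i * inC y)) = F z + inC y * f'.
  have -> : F z = z ord0 k * f + F (upd z k 0) by rewrite -{1}(upd_id z k) sF.
    by rewrite sF -/f /f'; ring.
have Gy y : G (upd z k (z ord0 k + 'i * inC y)) = G z + inC y * g'.
  have -> : G z = z ord0 k * g + G (upd z k 0) by rewrite -{1}(upd_id z k) sG.
    by rewrite sG -/g /g'; ring.
apply: (@quad_at0_ge0 _ _ (im (F z * g'^*) + im (f' * (G z)^*)) (im (f' * g'^*))).
move=> y y0 _; have := hk (z ord0 k + 'i * inC y).
rewrite Fy Gy => /(_ _) H'; apply: le_trans (H' _) _.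
  by rewrite !cE; lra.
by rewrite le_eqVlt; apply/orP; left; apply/eqP; rewrite !cE; ring.
Qed.

Lemma quad_coef0 (a b c : C) : (forall t, a * t ^+ 2 + b * t + c = 0) ->
  [/\ a = 0, b = 0 & c = 0].
Proof.
move=> h; have c0 : c = 0 by have := h 0; rewrite expr0n !mulr0 !add0r.
have h1 := h 1; have h2 := h (-1).
rewrite c0 expr1n !mulr1 addr0 in h1.
rewrite c0 sqrrN expr1n mulr1 mulrN1 addr0 in h2.
have a0 : a = 0.
  have : a * 2%:R = 0 by rewrite -[RHS](addr0 0) -{1}h1 -h2; ring.
  by move/eqP; rewrite mulf_eq0 pnatr_eq0 orbF => /eqP.
by split=> //; rewrite a0 add0r in h1.
Qed.

Section BorderedForm.
Variables (n m r : nat).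
Variables (P1 P2 : 'rV[C]_n -> 'M[C]_m) (q1 q2 : 'rV[C]_n -> C).
Variables (Phi : 'rV[C]_n -> 'M[C]_(m, r)) (Psi : 'rV[C]_n -> 'M[C]_(r, m)).
Hypotheses (aP1 : mxsepaff P1) (aP2 : mxsepaff P2) (aq1 : sepaff q1)
  (aq2 : sepaff q2) (aPhi : mxsepaff Phi) (aPsi : mxsepaff Psi).
Hypothesis wronsk : forall z, q2 z *: P1 z - q1 z *: P2 z = Phi z *m Psi z.
Hypothesis q1_neq0 : forall z : 'rV[C]_n, (forall i, 0 < im (z ord0 i)) -> q1 z != 0.
Hypothesis q21 :
  forall z : 'rV[C]_n, (forall i, 0 < im (z ord0 i)) -> 0 <= im (q2 z * (q1 z)^*).
Hypothesis P1q1 : forall (z : 'rV[C]_n) v,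
  (forall i, 0 < im (z ord0 i)) -> 0 <= im (hform v (P1 z) * (q1 z)^*).

Let G z := block_mx (P1 z) (Phi z) (Psi z) (q2 z)%:M.
Hypothesis realG : forall z : 'rV[C]_n, (forall i, im (z ord0 i) = 0) ->
  im (q1 z) = 0 /\ forall u, im (hform u (G z)) = 0.

(** In each variable the root of q1 lies in the closed lower half-plane when the
    other variables are in closed upper half-planes. With the other variables in
    open half-planes this is the zero-freeness of q1. *)
Let root_below (z : 'rV[C]_n) k : (forall i, 0 <= im (z ord0 i)) ->
  0 <= im (q1 (upd z k 0) * (q1 (upd z k 1) - q1 (upd z k 0))^*).
Proof.
move: z; apply: im_ge0_closure; first exact: sepaff_upd.
  by apply: sepaffB; apply: sepaff_upd.
move=> z zP; set be := q1 _; set al := _ - _; rewrite leNgt; apply/negP => neg.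
have al0 : al != 0.
  by apply: contraTneq neg => ->; rewrite !cE; lra.
suff : q1 (upd z k (- be / al)) != 0 by rewrite aq1 -/be -/al divfK // addNr eqxx.
by apply: q1_neq0 => i; rewrite updE; case: eqP => // _; apply: im_root_gt0.
Qed.

Lemma mxsepaff_bordered : mxsepaff G.
Proof.
move=> i j; rewrite /G.
case: (split_ordP i) => {}i ->; case: (split_ordP j) => {}j ->.
- by apply: sepaff_ext (aP1 i j) => z; rewrite block_mxEul.
- by apply: sepaff_ext (aPhi i j) => z; rewrite block_mxEur.
- by apply: sepaff_ext (aPsi i j) => z; rewrite block_mxEdl.
- apply: sepaff_ext (sepaffZ (i == j)%:R aq2) => z.
  by rewrite block_mxEdr mxE mulr_natl.
Qed.

(** On real points the expression vanishes, and the inequality is extended to one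
    more complex variable [t] at a time. For fixed values of the other variables q1 is
    t al + be and the form is a quotient of affine functions as studied above, so
    that Re h >= 0 has to be shown. When the root of q1 is real or infinite, h is
    the form of the block matrix conj(be) Ga - conj(al) De, whose blocks satisfy the
    hypotheses of [block_form_ge0]: its corners inherit their sign from P1 / q1
    and q2 / q1, and its Schur complement vanishes because W = Phi Psi, as a
    quadratic in t, is evaluated at the root of q1, where W = q2 P1. *)
Lemma bordered_form_ge0 (z : 'rV[C]_n) u : (forall i, 0 <= im (z ord0 i)) ->
  0 <= im (hform u (G z) * (q1 z)^*).
Proof.
move=> zP; move: z zP u.
apply: (coordwise_ind (D := fun _ t => im t = 0) (D' := fun _ t => 0 <= im t)
  (P := fun z => forall u, 0 <= im (hform u (G z) * (q1 z)^*))).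
  by move=> z /realG [h1 h2] u; rewrite !cE h1 h2; lra.
move=> z k zP real zk u.
have {}zP i : 0 <= im (z ord0 i) by case: (zP i) => // ->.
rewrite -(upd_id z k); move: (z ord0 k) zk => t t0.
have updP s : 0 <= im s -> forall i, 0 <= im (upd z k s ord0 i).
  by move=> s0 i; rewrite updE; case: eqP.
have := root_below k zP.
set be := q1 (upd z k 0); set al := _ - be => slq.
have qE s : q1 (upd z k s) = s * al + be by rewrite aq1.
have fE p (A : 'rV[C]_n -> 'M[C]_p) v s : mxsepaff A -> hform v (A (upd z k s)) =
    s * hform v (A (upd z k 1) - A (upd z k 0)) + hform v (A (upd z k 0)).
  by move=> h; rewrite (mxsepaffE _ _ _ h) hform_lin.
set Ga := G (upd z k 1) - G (upd z k 0); set De := G (upd z k 0).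
have real' v (x : R) :
    0 <= im ((inC x * hform v Ga + hform v De) * (inC x * al + be)^*).
  by rewrite -qE -(fE _ _ _ _ mxsepaff_bordered); apply: real.
rewrite qE (fE _ _ _ _ mxsepaff_bordered) -/Ga -/De; apply: cross_ge0 => //.
have [slq0|slq0] := eqVneq (im (be * al^*)) 0; last first.
  by apply: (wronsk_ge0_pole_below (real' u)); rewrite lt_neqAle eq_sym slq0.
have sfE p v (A B : 'M[C]_p) : hform v A * be^* - hform v B * al^*
    = hform v (be^* *: A - al^* *: B).
  by rewrite hformB !hformZ mulrC (mulrC _ al^*).
set sg := q2 (upd z k 1) - q2 (upd z k 0); set ta := q2 (upd z k 0).
set A1 := P1 (upd z k 1) - P1 (upd z k 0); set A0 := P1 (upd z k 0).
set B1 := Phi (upd z k 1) - Phi (upd z k 0); set B0 := Phi (upd z k 0).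
set D1 := Psi (upd z k 1) - Psi (upd z k 0); set D0 := Psi (upd z k 0).
have HE : be^* *: Ga - al^* *: De = block_mx (be^* *: A1 - al^* *: A0)
    (be^* *: B1 - al^* *: B0) (be^* *: D1 - al^* *: D0)
    (be^* * sg - al^* * ta)%:M.
  rewrite /Ga /De /G opp_block_mx add_block_mx !scale_block_mx opp_block_mx.
  rewrite add_block_mx -raddfB /= !scale_scalar_mx -raddfB /=.
  by [].
have q2E s : 0 <= im s -> 0 <= im ((s * sg + ta) * (s * al + be)^*).
  by move=> /updP/(im_ge0_closure aq2 aq1 q21); rewrite aq2 qE.
have q2r x := q2E (inC x) (lexx _).
have PE v s : 0 <= im s -> 0 <= im ((s * hform v A1 + hform v A0) * (s * al + be)^*).
  move=> /updP/(im_ge0_closure (sepaff_hform v aP1) aq1 (fun z => P1q1 v (z := z))).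
  by rewrite (fE _ _ _ _ aP1) qE.
have Pr v x := PE v (inC x) (lexx _).
rewrite sfE HE; apply: block_form_ge0.
- by move=> w; rewrite -HE -sfE; apply: (wronsk_real (real' w)).
- by move=> v; rewrite -sfE; apply: (wronsk_ge0 (Pr v)) => // s; apply: PE.
- by have := wronsk_ge0 q2r slq0 q2E; rewrite (mulrC _ sg) (mulrC _ ta).
- by have := wronsk_real q2r slq0; rewrite (mulrC _ sg) (mulrC _ ta).
set X1 := P2 (upd z k 1) - P2 (upd z k 0); set X0 := P2 (upd z k 0).
apply/matrixP => i j.
have := wronsk; move/(_ (upd z k _)).
(* The root of q1 has homogeneous coordinates conj be and - conj al. *)
have ab : be^* * al = al^* * be.
  by apply: complex_ext; move: slq0; rewrite !cE; lra.
(* The coefficients in t of the (i, j) entry of q2 P1 - q1 P2 - Phi Psi. *)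
pose c2 := sg * A1 i j - al * X1 i j - (B1 *m D1) i j.
pose c1 := sg * A0 i j + ta * A1 i j - al * X0 i j - be * X1 i j
  - (B1 *m D0) i j - (B0 *m D1) i j.
pose c0 := ta * A0 i j - be * X0 i j - (B0 *m D0) i j.
have addE p (X Y : 'M[C]_p) a b : (X + Y) a b = X a b + Y a b by rewrite mxE.
have oppE p (X : 'M[C]_p) a b : (- X) a b = - X a b by rewrite mxE.
have sclE p (X : 'M[C]_p) h a b : (h *: X) a b = h * X a b by rewrite mxE.
move=> W; have [c20 c10 c00] : [/\ c2 = 0, c1 = 0 & c0 = 0].
  apply: quad_coef0 => s; have /matrixP/(_ i j) := W s.
  rewrite (mxsepaffE k z s aP1) (mxsepaffE k z s aP2) (mxsepaffE k z s aPhi).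
  rewrite (mxsepaffE k z s aPsi) aq2 qE.
  rewrite -/A1 -/A0 -/B1 -/B0 -/D1 -/D0 -/X1 -/X0 -/sg -/ta.
  clearbody A1 A0 B1 B0 D1 D0 X1 X0 sg ta al be.
  rewrite mulmxDl !mulmxDr -!(scalemxAl, scalemxAr).
  rewrite !(addE, oppE, sclE) => /eqP; rewrite -subr_eq0 => /eqP <-.
  by rewrite /c2 /c1 /c0; ring.
clearbody A1 A0 B1 B0 D1 D0 X1 X0 sg ta al be.
rewrite mulmxBl !mulmxBr -!(scalemxAl, scalemxAr) !(addE, oppE, sclE).
apply/eqP; rewrite -subr_eq0; apply/eqP.
(* The identity c2 t^2 + c1 t + c0 = 0, homogenised and taken at the root. *)
transitivity (be^* ^+ 2 * c2 - be^* * al^* * c1 + al^* ^+ 2 * c0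
  + (be^* * al - al^* * be) * (be^* * X1 i j - al^* * X0 i j)).
  by rewrite /c2 /c1 /c0; ring.
by rewrite c20 c10 c00 ab subrr mul0r !mulr0 subrr !addr0.
Qed.

End BorderedForm.
End PickCore.

(** * Multi-affine polynomials *)

Section Polys.
Variable R : realType.
Local Notation C := (Cplx R).

Lemma poly_eq0_nat (u : {poly C}) : (forall k : nat, u.[k%:R] = 0) -> u = 0.
Proof.
move=> h; apply: (@roots_geq_poly_eq0 _ _ [seq k%:R | k <- iota 0 (size u)]).
- by apply/allP => x /mapP[k _ ->]; rewrite /root h.
- by rewrite map_inj_uniq ?iota_uniq // => a b /eqP; rewrite eqr_nat => /eqP.
- by rewrite size_map size_iota.
Qed.

Lemma horner_size_le2 (u : {poly C}) t : (size u <= 2)%N ->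
  u.[t] = t * (u.[1] - u.[0]) + u.[0].
Proof.
move=> su; have -> : u = u`_1 *: 'X + (u`_0)%:P.
  apply/polyP => -[|[|i]]; rewrite coefD coefZ coefX coefC ?mulr0 ?add0r //.
    by rewrite mulr1 addr0.
  by rewrite nth_default // (leq_trans su).
rewrite !hornerD !hornerZ !hornerX !hornerC.
by ring.
Qed.

Variable n : nat.
Implicit Types (z : 'rV[C]_n) (p : mpoly C n) (k : 'I_n).

Definition slice p z k : {poly C} :=
  mpoly.mmap (@polyC C) (fun i => if i == k then 'X else (z ord0 i)%:P) p.

Lemma sliceE p z k t : pteval p (upd z k t) = (slice p z k).[t].
Proof.
rewrite /pteval mpoly.mevalE /slice /mpoly.mmap horner_sum; apply: eq_bigr => m _.
rewrite hornerM hornerC /mpoly.mmap1 horner_prod; congr (_ * _).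
apply: eq_bigr => i _; rewrite horner_exp updE.
by case: eqP => _; rewrite ?hornerX ?hornerC.
Qed.

Lemma slice_deriv p z k : slice (mpoly.mderiv k p) z k = (slice p z k)^`().
Proof.
rewrite /slice; elim/mpoly.mpolyind: p => [|c m p _ _ IH].
  by rewrite mpoly.mderiv0 mpoly.mmap0 deriv0.
rewrite mpoly.mderivD mpoly.mderivZ !mpoly.mmapD !mpoly.mmapZ derivD IH; congr (_ + _).
rewrite mpoly.mderivX mpoly.mmapZ !mpoly.mmapX !mul_polyC derivZ; congr (_ *: _).
rewrite /mpoly.mmap1 (bigD1 k) //= eqxx [in RHS](bigD1 k) //= eqxx.
have cst (a : mpoly.multinom n) : \prod_(i < n | i != k)
    (if i == k then 'X else (z ord0 i)%:P) ^+ a i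
    = (\prod_(i < n | i != k) z ord0 i ^+ a i)%:P.
  rewrite rmorph_prod; apply: eq_bigr => i /negbTE ->.
  by rewrite rmorphXn.
rewrite !cst !(mulrC _ (polyC _)) !mul_polyC derivZ derivXn.
rewrite mpoly.mnmBE mpoly.mnm1E eqxx subn1.
have -> : \prod_(i < n | i != k) z ord0 i ^+ (mpoly.mnm_sub m (mpoly.mnm1 k)) i
    = \prod_(i < n | i != k) z ord0 i ^+ m i.
  apply: eq_bigr => i ik.
  by rewrite mpoly.mnmBE mpoly.mnm1E eq_sym (negbTE ik) subn0.
by rewrite scalerA mulrC -scalerA scaler_nat.
Qed.

(** A polynomial that vanishes as a function has derivatives that vanish as
    functions, and its coefficients are values at 0 of iterated derivatives, up to
    factorials. *)
Lemma pteval_eq0 p : (forall z, pteval p z = 0) -> p = 0.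
Proof.
have deriv0 k (q : mpoly C n) : (forall z, pteval q z = 0) ->
    forall z, pteval (mpoly.mderiv k q) z = 0.
  move=> h z; rewrite -(upd_id z k) sliceE slice_deriv.
  by rewrite (@poly_eq0_nat (slice q z k)) ?deriv0 ?horner0 // => t; rewrite -sliceE.
move=> p0; apply/mpoly.mpolyP => m; rewrite mpoly.mcoeff0.
have [N] := ubnP (mpoly.mdeg m); elim: N p p0 m => // N IH p p0 m mN.
have [/eqP|] := eqVneq (mpoly.mdeg m) 0%N.
  rewrite mpoly.mdeg_eq0 => /eqP ->.
  have [m0|/mpoly.memN_msupp_eq0 //] := boolP (mpoly.mnm0 \in mpoly.msupp p).
  have := p0 0; rewrite /pteval mpoly.mevalE (bigD1_seq _ m0) ?mpoly.msupp_uniq //=.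
  rewrite [X in _ * X]big1 ?mulr1 => [|i _]; last by rewrite mpoly.mnm0E expr0.
  rewrite big1 ?addr0 // => a a0.
  have [i ai] : exists i, a i != 0%N.
    apply/existsP; apply: contraNT a0 => /existsPn a0; apply/eqP/mpoly.mnmP => i.
    by rewrite mpoly.mnm0E; apply/eqP; have := a0 i; rewrite negbK.
  by rewrite (bigD1 i) //= mxE expr0n (negbTE ai) mul0r mulr0.
rewrite mpoly.mdegE sum_nat_eq0 => /forallPn[k /=]; rewrite -lt0n => mk.
have mE : m = mpoly.mnm_add (mpoly.mnm_sub m (mpoly.mnm1 k)) (mpoly.mnm1 k).
  apply/mpoly.mnmP => i; rewrite mpoly.mnmDE mpoly.mnmBE mpoly.mnm1E subnK //.
  by case: eqP => [<-|].
have := IH _ (deriv0 k p p0) (mpoly.mnm_sub m (mpoly.mnm1 k)).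
rewrite mpoly.mcoeff_mderiv -mE => H; apply/eqP; have := H _.
rewrite {1}mE mpoly.mdegD mpoly.mdeg1 addn1 in mN.
by move=> /(_ mN)/eqP; rewrite mulrn_eq0.
Qed.

Lemma multiaffine_sepaff p : multiaffine p -> sepaff (pteval p).
Proof.
move=> h.
pose F (m : mpoly.multinom n) z := \prod_i z ord0 i ^+ m i.
have aF m : mpoly.mcoeff m p != 0 -> sepaff (F m).
  move=> /h mle k z t; rewrite /F !(bigD1 k (P := xpredT)) //= !updE eqxx.
  have cst s : \prod_(i | i != k) upd z k s ord0 i ^+ m i
       = \prod_(i | i != k) z ord0 i ^+ m i.
    by apply: eq_bigr => i /negbTE ik; rewrite updE ik.
  rewrite !cst; have := mle k; case: (m k) => [_|[_|//]].
    by rewrite !expr0; ring.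
  by rewrite !expr1; ring.
have aS : sepaff (fun z => \sum_(m <- mpoly.msupp p | mpoly.mcoeff m p != 0)
    mpoly.mcoeff m p * F m z).
  by apply: sepaff_sum => m /aF; apply: sepaffZ.
apply: sepaff_ext aS => z.
rewrite /pteval mpoly.mevalE big_mkcond [LHS]/=; apply: eq_bigr => m _.
by case: eqP => [->|//]; rewrite mul0r.
Qed.

Lemma sepaff_slice p z k : sepaff (pteval p) -> (size (slice p z k) <= 2)%N.
Proof.
move=> h.
pose l : {poly C} := (pteval p (upd z k 1) - pteval p (upd z k 0)) *: 'X
   + (pteval p (upd z k 0))%:P.
suff -> : slice p z k = l.
  rewrite (leq_trans (size_polyD _ _)) // geq_max (leq_trans (size_scale_leq _ _)).
    by rewrite size_polyC; case: eqP.
  by rewrite size_polyX.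
apply/eqP; rewrite -subr_eq0; apply/eqP; apply: poly_eq0_nat => t.
by rewrite hornerD hornerN -sliceE h /l !hornerE; ring.
Qed.

(** The second derivative in each variable vanishes as a function, hence as a
    polynomial, and its coefficients are nonzero multiples of those of degree at
    least 2 in that variable. *)
Lemma sepaff_multiaffine p : sepaff (pteval p) -> multiaffine p.
Proof.
move=> h a pa k; rewrite leqNgt; apply: contra pa => ak.
have d2 : mpoly.mderiv k (mpoly.mderiv k p) = 0.
  apply: pteval_eq0 => z; rewrite -(upd_id z k) sliceE !slice_deriv.
  have /size1_polyC -> : (size (slice p z k)^`() <= 1)%N.
    by have := sepaff_slice z k h; have := lt_size_deriv (p := slice p z k); 
      case: eqVneq => [->|_ /(_ isT) s1 s2]; [rewrite deriv0 size_poly0|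
      rewrite -ltnS (leq_trans s1)].
  by rewrite derivC horner0.
pose b := mpoly.mnm_sub (mpoly.mnm_sub a (mpoly.mnm1 k)) (mpoly.mnm1 k).
have aE : a = mpoly.mnm_add (mpoly.mnm_add b (mpoly.mnm1 k)) (mpoly.mnm1 k).
  apply/mpoly.mnmP => i; rewrite !mpoly.mnmDE !mpoly.mnmBE mpoly.mnm1E.
  by case: eqP => [<-|]; rewrite ?subn0 ?addn0 // !addn1 subn1 subn1; case: (a k) ak => [|[]].
have : mpoly.mcoeff b (mpoly.mderiv k (mpoly.mderiv k p)) = 0 by rewrite d2 mpoly.mcoeff0.
by rewrite !mpoly.mcoeff_mderiv -aE => /eqP; rewrite !mulrn_eq0.
Qed.

(** Conjugates the coefficients; in this way the block Phi(conj z)^H of the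
    bordered matrix is a polynomial. *)
Definition conjp p : mpoly C n := mpoly.map_mpoly Num.conj p.

Lemma pteval_conjp p z : pteval (conjp p) z = (pteval p (conjpt z))^*.
Proof.
rewrite /pteval /conjp; elim/mpoly.mpolyind: p => [|c m p _ _ IH].
  by rewrite raddf0 !mpoly.meval0 rmorph0.
set v1 := fun i => z ord0 i; set v2 := fun i => conjpt z ord0 i.
have -> : mpoly.map_mpoly Num.conj (c *: mpoly.mpolyX C m + p)
   = c^* *: mpoly.mpolyX C m + mpoly.map_mpoly Num.conj p.
  by rewrite raddfD /= mpoly.map_mpolyZ mpoly.map_mpolyX.
rewrite !mpoly.mevalD IH !mpoly.mevalZ !mpoly.mevalX.
have -> : forall x y w : C, (x * y + w)^* = x^* * y^* + w^*.
  by move=> x y w; rewrite rmorphD rmorphM.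
have -> : (\prod_(i < n) v2 i ^+ m i)^* = \prod_(i < n) v1 i ^+ m i.
  rewrite rmorph_prod; apply: eq_bigr => i _.
  by rewrite rmorphXn /v2 mxE; congr (_ ^+ _); exact: conjCK.
by [].
Qed.

Lemma real_coefs_conjp p : real_coefs p -> conjp p = p.
Proof.
move=> h; apply/mpoly.mpolyP => m; rewrite mpoly.mcoeff_map_mpoly.
by apply/CrealP; apply: h.
Qed.

Lemma hermitian_coefs_conjp m (P : 'M[mpoly C n]_m) i j :
  hermitian_coefs P -> conjp (P i j) = P j i.
Proof.
move=> h; apply/mpoly.mpolyP => a; rewrite mpoly.mcoeff_map_mpoly.
have /is_hermitianmxP/matrixP/(_ j i) := h a.
by rewrite expr0 scale1r !mxE => ->.
Qed.
End Polys.

(** * Degree of the factor of a sum of squares *)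

Section Sos.
Variable R : realType.
Local Notation C := (Cplx R).
Variable n : nat.
Implicit Types (z : 'rV[C]_n) (p : mpoly C n) (k : 'I_n).

(** The class in which affineness of the factor Phi is tested: it is stable under
    differences and under fixing a coordinate, and real points suffice to decide
    whether a member vanishes. *)
Definition seppoly (F : 'rV[C]_n -> C) :=
  forall k z, exists u : {poly C}, forall t, F (upd z k t) = u.[t].

Lemma seppoly_pteval p : seppoly (pteval p).
Proof. by move=> k z; exists (slice p z k) => t; rewrite sliceE. Qed.

Lemma seppolyB F G : seppoly F -> seppoly G -> seppoly (fun z => F z - G z).
Proof.
move=> f g k z; have [u uE] := f k z; have [v vE] := g k z.
by exists (u - v) => t; rewrite uE vE hornerD hornerN.
Qed.

Lemma seppolyZ c F : seppoly F -> seppoly (fun z => c * F z).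
Proof.
by move=> f k z; have [u uE] := f k z; exists (c *: u) => t; rewrite uE hornerZ.
Qed.

Lemma seppoly_upd F j c : seppoly F -> seppoly (fun z => F (upd z j c)).
Proof.
move=> f k z; have [->|kj] := eqVneq k j.
  by exists (F (upd z j c))%:P => t; rewrite upd_upd hornerC.
have [u uE] := f k (upd z j c); exists u => t.
by rewrite (updC z _ _ kj).
Qed.

Lemma seppoly_eq0 F : seppoly F ->
  (forall z, (forall i, im (z ord0 i) = 0) -> F z = 0) -> forall z, F z = 0.
Proof.
move=> sF F0 z.
apply: (coordwise_ind (D := fun _ t => im t = 0) (D' := fun _ _ => True)
  (P := fun z => F z = 0)) => // {}z k _ h _.
have [u uE] := sF k z; rewrite -(upd_id z k) uE.
rewrite (@poly_eq0_nat _ u) ?horner0 // => j.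
rewrite -uE; apply: h.
by have := conjC_nat C j; move/(congr1 (@im R)); rewrite imJ; lra.
Qed.

Lemma coef_mul_top (u v : {poly C}) N : (size u <= N.+1)%N -> (size v <= N.+1)%N ->
  (u * v)`_(N + N) = u`_N * v`_N.
Proof.
move=> su sv; rewrite coefM.
have iN : (N < (N + N).+1)%N by rewrite ltnS leq_addr.
rewrite (bigD1 (Ordinal iN)) //= addnK big1 ?addr0 // => i.
rewrite -val_eqE /= => iN'; have [ltN|leN] := ltnP N i.
  by rewrite nth_default ?mul0r // (leq_trans su).
have {}iN' : (i < N)%N by rewrite ltn_neqAle iN'.
rewrite [v`__]nth_default ?mulr0 // (leq_trans sv) //.
by rewrite ltn_subRL ltn_add2r.
Qed.

(** The squares |u_i|^2 cannot cancel: if N >= 2 bounds all degrees, the coefficient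
    of degree 2 N of the sum is the sum of the squared moduli of those of degree N. *)
Lemma size_sumsq_le2 (I : finType) (u : I -> {poly C}) (w : {poly C}) :
  (size w <= 3)%N ->
  (forall t : R, w.[inC t] = \sum_i (u i).[inC t] * ((u i).[inC t])^*) ->
  forall i, (size (u i) <= 2)%N.
Proof.
move=> sw wE.
pose uc i := map_poly Num.conj (u i).
have wu : w = \sum_i u i * uc i.
  apply/eqP; rewrite -subr_eq0; apply/eqP; apply: poly_eq0_nat => k.
  have kR : (k%:R : C) = inC k%:R by rewrite /inC rmorph_nat.
  rewrite hornerD hornerN kR wE horner_sum; apply/eqP; rewrite subr_eq0; apply/eqP.
  apply: eq_bigr => i _; rewrite hornerM; congr (_ * _).
  rewrite -horner_map; congr (_.[_]).
  by apply: complex_ext; rewrite !cE ?oppr0.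
have step N : (2 <= N)%N -> (forall i, (size (u i) <= N.+1)%N) ->
    forall i, (size (u i) <= N)%N.
  move=> N2 su.
  have : w`_(N + N) = 0.
    rewrite nth_default // (leq_trans sw) // (@leq_trans (2 + 2)%N) //.
    exact: leq_add.
  rewrite wu coef_sum.
  under eq_bigr => i _.
    rewrite coef_mul_top ?size_map_poly // coef_map /= -normCK. over.
  move=> /eqP; rewrite psumr_eq0 => [/allP h i|i _]; last by rewrite exprn_ge0.
  have := h i (mem_index_enum _); rewrite /= sqrf_eq0 normr_eq0 => /eqP ui.
  have := su i; rewrite leq_eqVlt => /orP[/eqP sN|//].
  have : lead_coef (u i) = 0 by rewrite lead_coefE sN.
  by move/eqP; rewrite lead_coef_eq0 => /eqP ->; rewrite size_poly0.
have : forall i, (size (u i) <= 2 + \max_i size (u i))%N.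
  by move=> i; rewrite (leq_trans (leq_bigmax (F := fun i => size (u i)) i)) // leq_addl.
elim: (\max_i size (u i)) => [//|N IH] h; apply: IH; apply: step => //.
Qed.

(** At real points the i-th diagonal entry of W is the sum over j of |Phi_ij|^2, and
    it is quadratic in each variable because P1, P2, q1, q2 are affine. *)
Lemma sos_sepaff m r (P1 P2 : 'M[mpoly C n]_m) (q1 q2 : mpoly C n)
    (Phi : 'M[mpoly C n]_(m, r)) :
  (forall i j, sepaff (pteval (P1 i j))) -> (forall i j, sepaff (pteval (P2 i j))) ->
  sepaff (pteval q1) -> sepaff (pteval q2) ->
  is_sos_factor (wronskian P1 P2 q1 q2) Phi ->
  forall i j, sepaff (pteval (Phi i j)).
Proof.
move=> aP1 aP2 aq1 aq2 sos i j k z t.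
have real_case z' : (forall i, im (z' ord0 i) = 0) -> (size (slice (Phi i j) z' k) <= 2)%N.
  move=> z'R.
  pose w := slice q2 z' k * slice (P1 i i) z' k - slice q1 z' k * slice (P2 i i) z' k.
  apply: (@size_sumsq_le2 _ (fun j => slice (Phi i j) z' k) w).
    have mul3 (a b : {poly C}) : (size a <= 2)%N -> (size b <= 2)%N -> (size (a * b)%R <= 3)%N.
      move=> sa sb; rewrite (leq_trans (size_polyMleq _ _)) //.
      by rewrite -subn1 leq_subLR (@leq_trans (2 + 2)%N) // leq_add.
    rewrite (leq_trans (size_polyD _ _)) // geq_max size_polyN.
    by rewrite !mul3 // sepaff_slice.
  move=> s; have /matrixP/(_ i i) := sos (upd z' k (inC s)).
  have -> : conjpt (upd z' k (inC s)) = upd z' k (inC s).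
    apply/rowP => l; rewrite mxE updE; apply: complex_ext; rewrite !cE //.
    by case: eqP => _; rewrite ?z'R ?oppr0 // !cE oppr0.
  rewrite [LHS]mxE /wronskian !mxE /pteval mpoly.mevalB !mpoly.mevalM -!/(pteval _ _).
  rewrite !sliceE /w !hornerE => ->.
  by apply: eq_bigr => l _; rewrite !mxE sliceE.
(* The deviation from affineness is polynomial in z, so real z suffice. *)
pose D z := pteval (Phi i j) (upd z k t) - t * (pteval (Phi i j) (upd z k 1)
   - pteval (Phi i j) (upd z k 0)) - pteval (Phi i j) (upd z k 0).
apply/eqP; rewrite -subr_eq0 opprD addrA; apply/eqP; rewrite -/(D z).
apply: seppoly_eq0 => {z} [|z /real_case sz].
  have sp c : seppoly (fun z => pteval (Phi i j) (upd z k c)).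
    by apply: seppoly_upd; apply: seppoly_pteval.
  by apply: seppolyB => //; apply: seppolyB => //; apply: seppolyZ; apply: seppolyB.
by rewrite /D !sliceE (horner_size_le2 t sz); ring.
Qed.

End Sos.

(** * Zero-freeness of the denominator *)

Section Stable.
Variable R : realType.
Local Notation C := (Cplx R).
Variable n : nat.
Implicit Types (z : 'rV[C]_n) (k : 'I_n).

Lemma sepaff_eq0 (F : 'rV[C]_n -> C) (D : C -> Prop) a b :
  sepaff F -> a != b -> D a -> D b ->
  (forall z, (forall i, D (z ord0 i)) -> F z = 0) -> forall z, F z = 0.
Proof.
move=> aF ab Da Db F0 z.
apply: (coordwise_ind (D := fun _ => D) (D' := fun _ _ => True)
  (P := fun z => F z = 0)) => // {}z k _ h _.
have := h a Da; have := h b Db; rewrite (aF k z a) (aF k z b).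
have -> : F z = z ord0 k * (F (upd z k 1) - F (upd z k 0)) + F (upd z k 0).
  by rewrite -[in LHS](upd_id z k) aF.
set s := _ - _; set c := F (upd z k 0) => h2 h1.
have : (a - b) * s = 0 by rewrite -[RHS](subrr 0) -{1}h1 -h2; ring.
move=> /eqP; rewrite mulf_eq0 subr_eq0 (negbTE ab) /= => /eqP s0.
by move: h1; rewrite s0 !mulr0 !add0r.
Qed.

(** If q1 vanishes at a point y of the domain, then q2 does not vanish there, and
    q1 has slope 0 in each variable at y: otherwise, moving that variable slightly,
    the root t = - q2 / q1 could be sent into the upper half-plane. Moving the
    variables one by one, q1 vanishes on the whole domain and therefore
    identically. *)
Lemma stable_head_neq0 (q1 q2 : 'rV[C]_n -> C) : sepaff q1 -> sepaff q2 ->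
  (forall z t, (forall i, 0 < im (z ord0 i)) -> 0 < im t -> t * q1 z + q2 z != 0) ->
  (exists z, q1 z != 0) ->
  forall z, (forall i, 0 < im (z ord0 i)) -> q1 z != 0.
Proof.
move=> a1 a2 st [z1 nz] z zP; apply: contraNneq nz => q1z.
suff H (w : 'rV[C]_n) : (forall i, 0 < im (w ord0 i)) -> q1 w = 0.
  apply/eqP; apply: (sepaff_eq0 (D := fun t => 0 < im t) (a := 'i) (b := 'i + 1)) a1 _ _ _ H _.
  - by rewrite -subr_eq0 opprD addrA subrr sub0r oppr_eq0 oner_eq0.
  - by rewrite !cE.
  - by rewrite !cE; lra.
move=> wP.
apply: (coordwise_ind (D := fun i t => t = z ord0 i) (D' := fun _ t => 0 < im t)
   (P := fun w => q1 w = 0)) => // {wP}w => [h|k h q0 wk].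
  by rewrite -[RHS]q1z; congr q1; apply/rowP.
set y := upd w k (z ord0 k).
have yP i : 0 < im (y ord0 i).
  by rewrite updE; case: eqP => [_|_]; [|case: (h i) => [->|]].
have {}q0 : q1 y = 0 by apply: q0.
pose al := q1 (upd w k 1) - q1 (upd w k 0).
pose c := q2 (upd w k 1) - q2 (upd w k 0).
pose b := q2 y.
have b0 : b != 0 by have := st y 'i yP; rewrite q0 mulr0 add0r; apply; rewrite !cE.
have q1E s : q1 (upd y k (z ord0 k + s)) = s * al.
  have q0' := q0; rewrite /y (a1 k w (z ord0 k)) -/al in q0'.
  by rewrite upd_upd a1 -/al mulrDl (addrC (_ * al)) -addrA q0' addr0.
have q2E s : q2 (upd y k (z ord0 k + s)) = b + s * c.
  by rewrite upd_upd a2 -/c /b /y (a2 k w (z ord0 k)) -/c; ring.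
suff al0 : al = 0 by rewrite -(upd_id w k); have := q1E (w ord0 k - z ord0 k);
  rewrite addrC subrK upd_upd al0 mulr0.
apply/eqP/negPn/negP => al0.
(* Solving t (s al) + (b + s c) = 0 for t = i T - c / al gives s = i b / (T al),
   which is small for large T. *)
pose ga : R := im (c / al); pose be : R := im ('i * b / al); pose y0 : R := im (z ord0 k).
have y00 : 0 < y0 by apply: zP.
pose T : R := 1 + `|ga| + `|be| / y0.
have T1 : 0 < T.
  by rewrite /T; have := normr_ge0 ga; have := divr_ge0 (normr_ge0 be) (ltW y00); lra.
pose s : C := inC T^-1 * ('i * b / al); pose t : C := 'i * inC T - c / al.
have TT : inC T * inC T^-1 = 1 :> C.
  by apply: complex_ext; rewrite !cE ?divff ?gt_eqF //; ring.
have ii : 'i * 'i = -1 :> C by rewrite -expr2 sqrCi.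
have := st (upd y k (z ord0 k + s)) t; rewrite q1E q2E.
have -> : t * (s * al) + (b + s * c) = 0.
  have sal : s * al = inC T^-1 * ('i * b) by rewrite /s -mulrA divfK.
  have tE : t * (s * al) = ('i * inC T) * (s * al) - s * c.
    rewrite /t mulrBl; congr (_ - _).
    by rewrite (mulrC s al) mulrA divfK // mulrC.
  rewrite tE sal.
  have -> : 'i * inC T * (inC T^-1 * ('i * b)) = (inC T * inC T^-1) * ('i * 'i) * b by ring.
  by rewrite TT ii; ring.
rewrite eqxx => absurd; have : false; last by [].
apply: absurd => [i|].
  rewrite updE; case: eqP => // _.
  rewrite imD -/y0 /s imM re_inC im_inC mul0r addr0 -/be.
  have h1 : `|be| < T * y0.
    have -> : T * y0 = y0 + `|ga| * y0 + `|be| by rewrite /T; field; rewrite gt_eqF.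
    by have := mulr_ge0 (normr_ge0 ga) (ltW y00); lra.
  have h2 : - be <= `|be| by rewrite -normrN ler_norm.
  rewrite -(pmulr_rgt0 _ T1) mulrDr mulrA divff ?gt_eqF // mul1r; lra.
rewrite imD imN -/ga !cE mul0r mul1r add0r.
have := ler_norm ga; have := divr_ge0 (normr_ge0 be) (ltW y00); rewrite /T; lra.
Qed.
End Stable.

(** * Null sets *)

Section NullSets.
Variables (R : realType) (n : nat).
Implicit Types (A B : set 'rV[R]_n).

Lemma null_set_sub A B : A `<=` B -> null_set B -> null_set A.
Proof.
move=> AB nB e e0; have [K [a [b [ab BK s]]]] := nB e e0.
by exists K, a, b; split=> //; apply: subset_trans BK.
Qed.

Lemma null_set_count A :
  (forall e : R, 0 < e -> exists (T : countType) (K : set T) (a b : T -> 'rV[R]_n),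
    [/\ forall k i, a k ord0 i <= b k ord0 i,
        A `<=` \bigcup_(k in K) [set x | forall i, a k ord0 i <= x ord0 i <= b k ord0 i] &
        (\esum_(k in K) (\prod_(i < n) (b k ord0 i - a k ord0 i))%:E <= e%:E)%E]) ->
  null_set A.
Proof.
move=> h e e0; have [T [K [a [b [ab AK s]]]]] := h e e0.
exists (pickle @` K), (fun m => oapp a 0 (unpickle m)), (fun m => oapp b 0 (unpickle m)).
split.
- by move=> m i; case: (unpickle m) => [x|] //=; apply: ab.
- move=> x /AK[k Kk xk]; exists (pickle k); first by exists k.
  by rewrite /= pickleK.
- rewrite esum_image; last by move=> x y _ _; apply: (pcan_inj pickleK).
  by under eq_esum => k Kk do rewrite pickleK.
Qed.

Lemma null_set0 : null_set (set0 : set 'rV[R]_n).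
Proof.
move=> e e0; exists set0, (fun=> 0), (fun=> 0); split=> //.
by rewrite esum_set0 lee_fin ltW.
Qed.

Lemma null_set_bigcup (A : nat -> set 'rV[R]_n) :
  (forall k, null_set (A k)) -> null_set (\bigcup_k A k).
Proof.
move=> nA; apply: null_set_count => e e0.
have e2 k : 0 < e / (2 ^ k.+1)%:R.
  by rewrite divr_gt0 // ltr0n expn_gt0.
have {nA}nA k := nA k _ (e2 k).
have [K hK] := choice nA; have [a ha] := choice hK; have [b hb] := choice ha.
exists (nat * nat)%type, (setT `*`` K), (fun p => a p.1 p.2), (fun p => b p.1 p.2).
split.
- by move=> [k j] i; case: (hb k).
- move=> x [k _ Akx]; have [_ /(_ x Akx)[j Kj xj] _] := hb k.
  by exists (k, j).
- rewrite -(@esum_esum _ _ _ setT K (fun k j => (\prod_(i < n) (b k j ord0 i - a k j ord0 i))%:E)).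
    apply: (@le_trans _ _ (\esum_(k in setT) (e / (2 ^ k.+1)%:R)%:E)%E).
      by apply: le_esum => k _; case: (hb k).
    rewrite -nneseries_esumT; first exact: epsilon_trick0 (ltW e0).
    by move=> k; rewrite lee_fin ltW.
  move=> k j _ _; rewrite lee_fin prodr_ge0 // => i _.
  by rewrite subr_ge0; case: (hb k).
Qed.

Lemma null_set_union A B : null_set A -> null_set B -> null_set (A `|` B).
Proof.
move=> nA nB; apply: (@null_set_sub _ (\bigcup_k (if k is 0%N then A else B))).
  by move=> x [Ax|Bx]; [exists 0%N|exists 1%N].
by apply: null_set_bigcup => -[|k].
Qed.

Lemma null_set_fin A :
  (forall e : R, 0 < e -> exists (T : finType) (a b : T -> 'rV[R]_n),
    [/\ forall k i, a k ord0 i <= b k ord0 i,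
        A `<=` \bigcup_k [set x | forall i, a k ord0 i <= x ord0 i <= b k ord0 i] &
        \sum_k \prod_(i < n) (b k ord0 i - a k ord0 i) <= e]) ->
  null_set A.
Proof.
move=> h; apply: null_set_count => e e0; have [T [a [b [ab AK s]]]] := h e e0.
exists T, setT, a, b; split=> //.
rewrite esum_fset; [|exact: finite_finset|]; last first.
  by move=> k _; rewrite lee_fin prodr_ge0 // => i _; rewrite subr_ge0.
rewrite (fsbigE (index_enum T)) //=; last by move=> i _; rewrite mem_index_enum.
  rewrite sumEFin lee_fin (le_trans _ s) // big_mkcond /=.
  by apply: ler_sum => i _; rewrite in_setT.
exact: index_enum_uniq.
Qed.
End NullSets.

(** * Zero sets of multi-affine polynomials are null *)

Section ZeroSets.
Variable R : realType.
Local Notation C := (Cplx R).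

(** The l1 norm of R^2: a norm with values in R rather than in C. *)
Definition mag (z : C) : R := `|re z| + `|im z|.

Lemma mag_ge0 z : 0 <= mag z. Proof. exact: addr_ge0. Qed.

Lemma magD z w : mag (z + w) <= mag z + mag w.
Proof.
rewrite /mag !cE; have := ler_normD (re z) (re w); have := ler_normD (im z) (im w).
lra.
Qed.

Lemma magM z w : mag (z * w) <= mag z * mag w.
Proof.
rewrite /mag !cE.
have := ler_normB (re z * re w) (im z * im w).
have := ler_normD (re z * im w) (im z * re w).
by rewrite !normrM; lra.
Qed.

Lemma mag_gt0 z : z != 0 -> 0 < mag z.
Proof.
move=> z0; rewrite lt_neqAle mag_ge0 andbT eq_sym; apply: contraNneq z0 => /eqP.
rewrite paddr_eq0 // !normr_eq0 => /andP[/eqP h1 /eqP h2].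
by apply/eqP/complex_ext.
Qed.

Lemma mag_real t z : mag (inC t * z) = `|t| * mag z.
Proof. by rewrite /mag !cE !mul0r subr0 addr0 !normrM; ring. Qed.

Variable n : nat.
Implicit Types (x y : 'rV[R]_n) (h : 'rV[R]_n -> C) (k : 'I_n).

(** The bound is included because the Lipschitz constant of a product depends on
    it. *)
Definition bounded_lip h := forall B : R, exists M L : R,
  [/\ 0 <= M, 0 <= L, forall x, (forall i, `|x ord0 i| <= B) -> mag (h x) <= M
    & forall x y (d : R), (forall i, `|x ord0 i| <= B) -> (forall i, `|y ord0 i| <= B) ->
       (forall i, `|x ord0 i - y ord0 i| <= d) -> mag (h x - h y) <= L * d].

Lemma bounded_lip_cst c : bounded_lip (fun=> c).
Proof.
move=> B; exists (mag c), 0; split=> //; first exact: mag_ge0.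
by move=> *; rewrite subrr mul0r /mag !cE normr0 addr0.
Qed.

Lemma bounded_lip_coord k : bounded_lip (fun x => inC (x ord0 k)).
Proof.
move=> B; exists `|B|, 1; split=> //.
  move=> x /(_ k) xB; rewrite /mag !cE normr0 addr0.
  exact: le_trans xB (ler_norm _).
by move=> x y d _ _ /(_ k); rewrite /mag !cE oppr0 addr0 normr0 addr0 mul1r.
Qed.

Lemma bounded_lipD h1 h2 : bounded_lip h1 -> bounded_lip h2 ->
  bounded_lip (fun x => h1 x + h2 x).
Proof.
move=> H1 H2 B; have [M1 [L1 [M10 L10 b1 l1]]] := H1 B.
have [M2 [L2 [M20 L20 b2 l2]]] := H2 B; exists (M1 + M2), (L1 + L2); split.
- exact: addr_ge0.
- exact: addr_ge0.
- by move=> x xB; apply: le_trans (magD _ _) _; apply: lerD; auto.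
- move=> x y d xB yB xy; rewrite opprD addrACA mulrDl.
  by apply: le_trans (magD _ _) _; apply: lerD; auto.
Qed.

Lemma bounded_lipM h1 h2 : bounded_lip h1 -> bounded_lip h2 ->
  bounded_lip (fun x => h1 x * h2 x).
Proof.
move=> H1 H2 B; have [M1 [L1 [M10 L10 b1 l1]]] := H1 B.
have [M2 [L2 [M20 L20 b2 l2]]] := H2 B; exists (M1 * M2), (M1 * L2 + M2 * L1); split.
- exact: mulr_ge0.
- by apply: addr_ge0; exact: mulr_ge0.
- by move=> x xB; apply: le_trans (magM _ _) _; apply: ler_pM; rewrite ?mag_ge0 //; auto.
- move=> x y d xB yB xy.
  have -> : h1 x * h2 x - h1 y * h2 y = h1 x * (h2 x - h2 y) + h2 y * (h1 x - h1 y) by ring.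
  rewrite mulrDl -!mulrA; apply: le_trans (magD _ _) _; apply: lerD;
    apply: le_trans (magM _ _) _; apply: ler_pM; rewrite ?mag_ge0 //; auto.
Qed.

Lemma bounded_lip_upd h k c : bounded_lip h -> bounded_lip (fun x => h (upd x k c)).
Proof.
move=> H B; have [M [L [M0 L0 b l]]] := H (Num.max B `|c|); exists M, L.
have updB x : (forall i, `|x ord0 i| <= B) ->
    forall i, `|upd x k c ord0 i| <= Num.max B `|c|.
  by move=> xB i; rewrite updE le_max; case: eqP; rewrite ?xB ?lexx ?orbT.
split=> //; first by move=> x xB; apply: b; apply: updB.
move=> x y d xB yB xy; apply: l; [exact: updB|exact: updB|].
move=> i; rewrite !updE; case: eqP => // _; rewrite subrr normr0.
exact: le_trans (normr_ge0 _) (xy i).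
Qed.

Lemma bounded_lip_pteval (p : mpoly C n) : bounded_lip (fun x => pteval p (real_pt x)).
Proof.
have ext h1 h2 : h1 =1 h2 -> bounded_lip h1 -> bounded_lip h2.
  by move=> e H B; have [M [L [? ? b l]]] := H B; exists M, L; split=> // *;
    rewrite -!e; auto.
elim/mpoly.mpolyind: p => [|c m p _ _ IH].
  by apply: ext (bounded_lip_cst 0) => x; rewrite /pteval mpoly.meval0.
apply: (ext (fun x => c * \prod_i (inC (x ord0 i)) ^+ m i + pteval p (real_pt x))).
  move=> x; rewrite /pteval mpoly.mevalD mpoly.mevalZ mpoly.mevalX.
  by congr (c * _ + _); apply: eq_bigr => i _; rewrite mxE.
apply: bounded_lipD => //; apply: bounded_lipM; first exact: bounded_lip_cst.
elim: (index_enum _) => [|i s IHs].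
  by apply: ext (bounded_lip_cst 1) => x; rewrite big_nil.
apply: (ext (fun x => inC (x ord0 i) ^+ m i * \prod_(j <- s) inC (x ord0 j) ^+ m j)).
  by move=> x; rewrite big_cons.
apply: bounded_lipM => //; elim: (m i) => [|e IHe].
  by apply: ext (bounded_lip_cst 1) => x; rewrite expr0.
apply: (ext (fun x => inC (x ord0 i) * inC (x ord0 i) ^+ e)).
  by move=> x; rewrite exprS.
by apply: bounded_lipM => //; apply: bounded_lip_coord.
Qed.

Definition coord_slope h k x := h (upd x k 1) - h (upd x k 0).

Definition real_sepaff h := forall k x t, h (upd x k t) = inC t * coord_slope h k x + h (upd x k 0).

Lemma cell_exists (d : R) m (u : R) : 0 <= u -> u <= m.+1%:R * d ->
  exists j : 'I_m.+1, j%:R * d <= u <= j.+1%:R * d.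
Proof.
elim: m => [|m IH] u0 um; first by exists ord0; rewrite mul0r u0.
have [um'|um'] := leP u (m.+1%:R * d).
  by have [j jP] := IH u0 um'; exists (widen_ord (leqnSn _) j).
by exists ord_max; rewrite ltW.
Qed.

(** On a coordinate line h is affine with slope of size at least 1 / B, so two zeros
    whose other coordinates differ by at most d have k-th coordinates that differ by
    at most B L d: the set is a Lipschitz graph over the other coordinates. Cut their
    cube into cells of side d. Above each cell one box of height 2 B L d suffices,
    and the total volume is proportional to d. *)
Lemma graph_null h k (B : R) : real_sepaff h -> bounded_lip h -> 0 < B ->
  null_set [set x : 'rV[R]_n | [/\ forall i, `|x ord0 i| <= B, B^-1 <= mag (coord_slope h k x)
     & h x = 0]].
Proof.
move=> ah lh B0; set S := [set x | _].
have [_ [L [_ L0 _ hL]]] := lh B.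
have close x y (d : R) : S x -> S y -> (forall i, i != k -> `|x ord0 i - y ord0 i| <= d) ->
    0 <= d -> `|x ord0 k - y ord0 k| <= B * L * d.
  move=> [xB sx hx] [yB sy hy] xy d0.
  pose y' := upd x k (y ord0 k).
  have hy' : h y' = inC (y ord0 k - x ord0 k) * coord_slope h k x.
    have hx' := hx; rewrite -(upd_id x k) ah in hx'.
    rewrite /y' ah -[RHS]addr0 -hx'.
    by rewrite /inC raddfB /=; ring.
  have := hL y' y d; rewrite hy subr0 hy' mag_real => H.
  have {}H : `|y ord0 k - x ord0 k| * mag (coord_slope h k x) <= L * d.
    apply: H => // i; rewrite updE; case: eqP => // [->|/eqP ik].
      by rewrite subrr normr0.
    exact: xy.
  rewrite distrC -mulrA -ler_pdivrMl //; apply: le_trans H.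
  by rewrite mulrC ler_wpM2l.
apply: null_set_fin => e e0.
pose V := \prod_(i < n | i != k) (B + B).
have V0 : 0 <= V by apply: prodr_ge0 => i _; lra.
pose c0 := 2 * (B * L * (B + B)) * V.
have c00 : 0 <= c0 by rewrite /c0 !mulr_ge0 //; lra.
have [m hm] : exists m : nat, c0 / m.+1%:R <= e.
  exists (Num.bound (c0 / e)); rewrite ler_pdivrMr ?ltr0Sn // mulrC -ler_pdivrMr //.
  apply: ltW; apply: lt_le_trans (archi_boundP _) _; first by rewrite divr_ge0 // ltW.
  by rewrite ler_nat.
pose d := (B + B) / m.+1%:R.
have d0 : 0 <= d by rewrite /d divr_ge0 //; lra.
have dm : m.+1%:R * d = B + B by rewrite /d mulrC divfK // pnatr_eq0.
pose incell (c : {ffun 'I_n -> 'I_m.+1}) x := S x /\ c k = ord0 /\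
  forall i, i != k -> - B + (c i)%:R * d <= x ord0 i <= - B + (c i).+1%:R * d.
pose pt c := if pselect (exists x, incell c x) is left ex then projT1 (cid ex) else 0.
have ptP c x : incell c x -> incell c (pt c).
  move=> cx; rewrite /pt; case: pselect => [ex|]; first by case: cid.
  by case; exists x.
pose rho := B * L * d.
have rho0 : 0 <= rho by apply: mulr_ge0 => //; apply: mulr_ge0 => //; apply: ltW.
(* A cell is a function c with c k = 0. Functions with c k <> 0 index boxes that
   are flat in direction k, which makes the sum of volumes a product over i. *)
exists ({ffun 'I_n -> 'I_m.+1} : finType).
exists (fun c : {ffun 'I_n -> 'I_m.+1} => \row_i
   if i == k then (if c k == ord0 then pt c ord0 k - rho else 0) else - B + (c i)%:R * d).
exists (fun c : {ffun 'I_n -> 'I_m.+1} => \row_i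
   if i == k then (if c k == ord0 then pt c ord0 k + rho else 0) else - B + (c i).+1%:R * d).
split.
- move=> c i; rewrite !mxE; case: eqP => _; first by case: eqP => // _; lra.
  by rewrite lerD2l ler_wpM2r // ler_nat.
- move=> x Sx; have [xB _ _] := Sx.
  have cell i : exists j : 'I_m.+1,
      if i == k then j == ord0 else - B + j%:R * d <= x ord0 i <= - B + j.+1%:R * d.
    case: eqP => _; first by exists ord0.
    have := xB i; rewrite ler_norml => /andP[h1 h2].
    have [||j /andP[j1 j2]] := @cell_exists d m (x ord0 i + B); [lra|rewrite dm; lra|].
    by exists j; apply/andP; split; lra.
  have [c cP] := choice cell.
  have ck : c k = ord0 by have := cP k; rewrite eqxx => /eqP.
  pose c' : {ffun 'I_n -> 'I_m.+1} := [ffun i => c i].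
  have cx : incell c' x.
    split=> //; split; first by rewrite ffunE.
    by move=> i /negbTE ik; have := cP i; rewrite ik ffunE.
  have [Sp [_ pP]] := ptP _ _ cx; have [_ [_ xP]] := cx.
  exists c' => // i; rewrite !mxE; case: eqP => [->|/eqP ik].
    rewrite ffunE ck eqxx.
    have := @close x (pt c') d Sx Sp _ d0.
    rewrite -/rho ler_norml => H.
    suff /H/andP[] : forall i, i != k -> `|x ord0 i - pt c' ord0 i| <= d.
      by move=> h1 h2; apply/andP; split; lra.
    move=> j jk; have /andP[p1 p2] := pP j jk; have /andP[x1 x2] := xP j jk.
    have dE : (c' j).+1%:R * d = (c' j)%:R * d + d by rewrite -natr1 mulrDl mul1r.
    by rewrite ler_norml; apply/andP; split; lra.
  exact: xP.
- pose w (i : 'I_n) (j : 'I_m.+1) : R := if i == k then (if j == ord0 then 2 * rho else 0) else d.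
  apply: (@le_trans _ _ (\sum_(c : {ffun 'I_n -> 'I_m.+1}) \prod_i w i (c i))).
    apply: ler_sum => c _; apply: ler_prod => i _; rewrite !mxE /w.
    case: eqP => [->|_]; first by case: eqP => _; apply/andP; split; lra.
    have dE : (c i).+1%:R * d = (c i)%:R * d + d by rewrite -natr1 mulrDl mul1r.
    by apply/andP; split; lra.
  rewrite -bigA_distr_bigA (bigD1 k) //=.
  rewrite (bigD1 ord0) //= {1}/w !eqxx big1 ?addr0; last first.
    by move=> j /negbTE jk; rewrite /w eqxx jk.
  rewrite (eq_bigr (fun=> B + B)); last first.
    move=> i /negbTE ik; rewrite /w ik sumr_const card_ord -mulr_natl; exact: dm.
  rewrite -/V; apply: le_trans hm; rewrite /c0 /rho /d le_eqVlt; apply/orP; left.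
  by apply/eqP; ring.
Qed.

(** A zero of h is a zero of its slope in some variable k, a function that does not
    depend on that variable, or else lies on one of countably many graphs. The
    induction is on a list of variables outside which h is constant. *)
Lemma zero_set_null h : real_sepaff h -> bounded_lip h -> (exists x, h x != 0) ->
  null_set [set x | h x = 0].
Proof.
suff H (s : seq 'I_n) : forall h, (forall k x t, k \notin s -> h (upd x k t) = h x) ->
    real_sepaff h -> bounded_lip h -> (exists x, h x != 0) -> null_set [set x | h x = 0].
  by apply: (H (enum 'I_n)) => k x t; rewrite mem_enum.
elim: s => [|k s IH] {}h hs ah lh [x0 hx0].
  apply: (null_set_sub _ (@null_set0 R n)) => x /= hx.
  have : h x0 = 0; last by move=> h0; rewrite h0 eqxx in hx0.
  apply: (coordwise_ind (D := fun i t => t = x ord0 i) (D' := fun _ _ => True)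
    (P := fun y => h y = 0)) => // [y yx|y k _ hy _].
    by rewrite -[RHS]hx; congr h; apply/rowP.
  by rewrite -(hs k y (x ord0 k)) //; apply: hy.
have sk x t : coord_slope h k (upd x k t) = coord_slope h k x by rewrite /coord_slope !upd_upd.
have [sz|/existsNP[x1 sx1]] := pselect (forall x, coord_slope h k x = 0).
  apply: IH => //; last by exists x0.
  move=> j x t js; have [->|jk] := eqVneq j k; last by apply: hs; rewrite inE negb_or jk.
  rewrite ah sz mulr0 add0r; have := ah k x (x ord0 k).
  by rewrite upd_id sz mulr0 add0r.
have lip_slope : bounded_lip (coord_slope h k).
  have B1 := bounded_lip_upd k 1 lh; have B0 := bounded_lip_upd k 0 lh.
  have := bounded_lipD B1 (bounded_lipM (bounded_lip_cst (-1)) B0).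
  have -> // : (fun x => h (upd x k 1) + -1 * h (upd x k 0)) = coord_slope h k.
  by apply/funext => x; rewrite mulN1r.
have aff_slope : real_sepaff (coord_slope h k).
  move=> j x t; have [->|jk] := eqVneq j k.
    by rewrite {1}sk {2}/coord_slope !sk subrr mulr0 add0r.
  have E c : h (upd (upd x j t) k c) =
      inC t * (h (upd (upd x j 1) k c) - h (upd (upd x j 0) k c)) + h (upd (upd x j 0) k c).
    by rewrite !(@updC _ _ _ j k) // ah.
  by rewrite [LHS]/coord_slope !E /coord_slope; ring.
have slope_null : null_set [set x | coord_slope h k x = 0].
  apply: IH => //; last by exists x1; apply/eqP.
  move=> j x t js; have [->|jk] := eqVneq j k; first exact: sk.
  by rewrite /coord_slope !(@updC _ _ _ j k) // !(hs j) // inE negb_or jk.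
have graphs := null_set_bigcup (fun N => @graph_null h k N.+1%:R ah lh (ltr0Sn _ _)).
have U := null_set_union slope_null graphs.
refine (null_set_sub _ U) => x /= hx.
have [sx|/eqP sx] := pselect (coord_slope h k x = 0); [by left|right].
have sp := mag_gt0 sx.
pose b := \sum_i `|x ord0 i| + (mag (coord_slope h k x))^-1.
have s0 : 0 <= \sum_i `|x ord0 i| by apply: sumr_ge0.
have b0 : 0 <= b by apply: addr_ge0 => //; rewrite invr_ge0 mag_ge0.
have bN : b <= (Num.bound b).+1%:R.
  by apply: ltW; apply: lt_le_trans (archi_boundP b0) _; rewrite ler_nat.
exists (Num.bound b) => //; split=> //.
  move=> i; apply: le_trans bN; rewrite /b (bigD1 i) //= -addrA lerDl.
  by apply: addr_ge0; [apply: sumr_ge0|rewrite invr_ge0 mag_ge0].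
rewrite -[leRHS]invrK lef_pV2 ?posrE ?invr_gt0 ?ltr0Sn //.
by apply: le_trans bN; rewrite /b lerDr.
Qed.

Lemma real_pt_upd x k t : real_pt (upd x k t) = upd (real_pt x) k (inC t).
Proof. by apply/rowP => i; rewrite mxE !updE mxE; case: eqP. Qed.

Lemma poly_zero_null (p : mpoly C n) : sepaff (pteval p) -> p != 0 ->
  null_set [set x : 'rV[R]_n | pteval p (real_pt x) = 0].
Proof.
move=> ap p0; apply: (@zero_set_null (fun x => pteval p (real_pt x))).
- by move=> k x t; rewrite /coord_slope !real_pt_upd; exact: ap.
- exact: bounded_lip_pteval.
apply: contrapT => /forallNP p00; move/eqP: p0; apply.
apply: pteval_eq0; apply: seppoly_eq0; first exact: seppoly_pteval.
move=> z zR; have -> : z = real_pt (\row_i re (z ord0 i)).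
  by apply/rowP => i; rewrite !mxE; apply: complex_ext.
by have /negP := p00 (\row_i re (z ord0 i)); rewrite negbK => /eqP.
Qed.

End ZeroSets.

(** * The bordered function *)

Section Bordered.
Variable R : realType.
Local Notation C := (Cplx R).

Lemma differentiable_ext n (V : normedModType C) (f g : 'rV[C]_n -> V) z :
  f =1 g -> differentiable f z -> differentiable g z.
Proof. by move=> /funext ->. Qed.

Lemma differentiable_pteval n (p : mpoly C n) (z : 'rV[C]_n) :
  differentiable (pteval p : 'rV[C]_n -> C) z.
Proof.
have cst0 c : differentiable (fun=> c : C) z by exact: differentiable_cst.
elim/mpoly.mpolyind: p => [|c m p _ _ IH].
  by apply: differentiable_ext (cst0 0) => w; rewrite /pteval mpoly.meval0.
pose M (w : 'rV[C]_n) : C := \prod_i (w ord0 i) ^+ m i.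
apply: (@differentiable_ext _ _ ((fun w => M w *: (c : C^o)) + pteval p)).
  by move=> w; rewrite /pteval mpoly.mevalD mpoly.mevalZ mpoly.mevalX mulrC.
apply: differentiableD; last exact: IH.
apply: differentiableZl.
rewrite /M; elim: (index_enum _) => [|i s IHs].
  by apply: differentiable_ext (cst0 1) => w; rewrite big_nil.
apply: (@differentiable_ext _ _ ((fun w => (w ord0 i) ^+ m i : C) *
    (fun w => \prod_(j <- s) (w ord0 j) ^+ m j : C))).
  by move=> w; rewrite big_cons.
apply: differentiableM => //; elim: (m i) => [|e IHe].
  by apply: differentiable_ext (cst0 1) => w; rewrite expr0.
apply: (@differentiable_ext _ _ ((fun w => w ord0 i : C) * (fun w => (w ord0 i) ^+ e : C))).
  by move=> w; rewrite exprS.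
by apply: differentiableM => //; apply: differentiable_coord.
Qed.

Lemma differentiable_mxeval_div n m k (P : 'M[mpoly C n]_(m, k)) (q : mpoly C n) z :
  pteval q z != 0 ->
  differentiable (fun w => (pteval q w)^-1 *: mxeval P w) z.
Proof.
move=> qz.
pose F i j (w : 'rV[C]_n) : C := (pteval q w)^-1 * pteval (P i j) w.
apply: (@differentiable_ext _ _
    (\sum_(i < m) \sum_(j < k) (fun w => F i j w *: (delta_mx i j : 'M[C]_(m, k))))).
  move=> w; rewrite fct_sumE.
  under eq_bigr do rewrite fct_sumE.
  rewrite [RHS]matrix_sum_delta; apply: eq_bigr => i _; apply: eq_bigr => j _.
  by rewrite !mxE.
apply: differentiable_sum => i; apply: differentiable_sum => j.
apply: differentiableZl.
apply: (@differentiableM _ _ (fun w => (pteval q w)^-1)); last exact: differentiable_pteval.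
by apply: differentiableV => //; apply: differentiable_pteval.
Qed.

Lemma adj_adj m k (A : 'M[C]_(m, k)) : (A ^t*) ^t* = A.
Proof. by apply/matrixP => i j; rewrite !mxE; exact: conjCK. Qed.

Lemma hform_adj n (u : 'rV[C]_n) (A : 'M[C]_n) : hform u (A ^t*) = (hform u A)^*.
Proof.
rewrite /hform.
have -> : u *m A ^t* *m u ^t* = ((u *m A *m u ^t*) ^t*).
  rewrite -{1}[u]adj_adj.
  by rewrite !trmx_mul !map_mxM mulmxA /=; congr (_ *m _ *m _);
    apply/matrixP => i j; rewrite !mxE.
by rewrite !mxE.
Qed.

Lemma hermsymmxE m (A : 'M[C]_m) : (A \is hermsymmx) <-> A ^t* = A.
Proof.
split=> [/is_hermitianmxP|e]; first by rewrite expr0 scale1r => <-.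
by apply/is_hermitianmxP; rewrite expr0 scale1r e.
Qed.

Lemma hform_imag n (u : 'rV[C]_n) (A : 'M[C]_n) :
  hform u ((2 * 'i)^-1 *: (A - A ^t*)) = inC (im (hform u A)).
Proof.
have -> : hform u ((2 * 'i)^-1 *: (A - A ^t*)) =
    (2 * 'i)^-1 * (hform u A - hform u (A ^t*)).
  by rewrite hformZ hformB.
rewrite hform_adj; set x := hform u A.
have -> : x - x^* = (2 * 'i) * inC (im x) by apply: complex_ext; rewrite !cE; ring.
have i0 : (2 * 'i : C) != 0 by rewrite mulf_neq0 ?pnatr_eq0 ?neq0Ci.
by rewrite mulKf.
Qed.

Lemma psd_imag m (A : 'M[C]_m) :
  psd ((2 * 'i)^-1 *: (A - A ^t*)) <-> forall u, 0 <= im (hform u A).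
Proof.
split=> [[_ h] u|h].
  by have := h u; rewrite -/(hform _ _) hform_imag ler0c.
split; last by move=> u; rewrite -/(hform _ _) hform_imag ler0c.
apply/hermsymmxE/matrixP => i j; rewrite !mxE.
have -> : (2 * 'i)^-1 = - 'i * inC 2^-1 :> C.
  have i0 : (2 * 'i : C) != 0 by rewrite mulf_neq0 ?pnatr_eq0 ?neq0Ci.
  apply: (mulfI i0); rewrite divff //.
  have -> : (2 : C) = inC 2 by rewrite /inC rmorph_nat.
  by apply: complex_ext; rewrite !cE; field.
by apply: complex_ext; rewrite !cE; ring.
Qed.

Variables (n m r : nat).
Implicit Types (z : 'rV[C]_n).
Variables (P1 P2 : 'M[mpoly C n]_m) (q1 q2 : mpoly C n).
Variable (Phi : 'M[mpoly C n]_(m, r)).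

Hypotheses (aP1 : forall i j, sepaff (pteval (P1 i j)))
  (aP2 : forall i j, sepaff (pteval (P2 i j)))
  (aq1 : sepaff (pteval q1)) (aq2 : sepaff (pteval q2)).
Hypothesis W_sos : is_sos_factor (wronskian P1 P2 q1 q2) Phi.

Let Psi z : 'M[C]_(r, m) := (mxeval Phi (conjpt z)) ^t*.

Lemma mxeval_wronskian z : mxeval (wronskian P1 P2 q1 q2) z =
  pteval q2 z *: mxeval P1 z - pteval q1 z *: mxeval P2 z.
Proof.
by apply/matrixP => i j; rewrite !mxE /pteval mpoly.mevalB !mpoly.mevalM.
Qed.

(** The lower right block plus t I is (q / q1) I with q = t q1 + q2, so that its
    inverse is a scalar and the product of the two off-diagonal blocks is W. *)
Lemma bordered_schur z t : pteval q1 z != 0 -> t * pteval q1 z + pteval q2 z != 0 ->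
  let g := bordered q1 P1 Phi q2 z in
  drsubmx g + t%:M \in unitmx /\
  (t * pteval q1 z + pteval q2 z)^-1 *: (t *: mxeval P1 z + mxeval P2 z) =
  ulsubmx g - ursubmx g *m invmx (drsubmx g + t%:M) *m dlsubmx g.
Proof.
move=> q1z qz g; rewrite /g /bordered scale_block_mx.
rewrite block_mxKul block_mxKur block_mxKdl block_mxKdr scale_scalar_mx -raddfD /=.
set s := _ + t.
have sE : s = (pteval q1 z)^-1 * (t * pteval q1 z + pteval q2 z).
  by rewrite /s mulrDr addrC mulrCA mulVf // mulr1.
have s0 : s != 0 by rewrite sE mulf_neq0 // invr_eq0.
split; first by rewrite unitmxE det_scalar unitfE expf_neq0.
rewrite invmx_scalar mul_mx_scalar -!scalemxAl -!scalemxAr -W_sos mxeval_wronskian.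
apply/matrixP => i j; rewrite !mxE sE.
set a := pteval q1 z in q1z qz *; set b := pteval q2 z in qz *.
move: (pteval (P1 i j) z) (pteval (P2 i j) z) => x y; clearbody a b.
by field; rewrite q1z.
Qed.

Let Gp : 'M[mpoly C n]_(m + r) :=
  block_mx P1 Phi (\matrix_(i, j) conjp (Phi j i)) q2%:M.

Let GpE z : mxeval Gp z = block_mx (mxeval P1 z) (mxeval Phi z) (Psi z) (pteval q2 z)%:M.
Proof.
rewrite /mxeval /Gp map_block_mx; congr block_mx.
  by apply/matrixP => i j; rewrite !mxE pteval_conjp.
apply/matrixP => i j; rewrite !mxE; case: eqP => _ //.
by rewrite mulr0n /pteval mpoly.meval0.
Qed.

Let aPhi i j : sepaff (pteval (Phi i j)).
Proof. exact: sos_sepaff W_sos i j. Qed.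

Let aPsi : mxsepaff Psi.
Proof.
move=> i j; apply: (@sepaff_ext _ _ (fun w => (pteval (Phi j i) (conjpt w))^*)).
  by move=> w; rewrite /Psi 3!mxE.
move=> k z t.
have cu c : conjpt (upd z k c) = upd (conjpt z) k c^*.
  by apply/rowP => l; rewrite !mxE; case: eqP.
have key (x a b : C) : (x^* * (a - b) + b)^* = x * (a^* - b^*) + b^*.
  by apply: complex_ext; rewrite !cE; ring.
rewrite !cu conjC0 conjC1 aPhi.
exact: key.
Qed.

Let aGp i j : sepaff (pteval (Gp i j)).
Proof.
have H : mxsepaff (fun z => mxeval Gp z).
  move=> {}i {}j k z t; rewrite !GpE.
  have a1 : mxsepaff (mxeval P1) by move=> a b; apply: sepaff_ext (aP1 a b) => w; rewrite mxE.
  have a2 : mxsepaff (mxeval Phi) by move=> a b; apply: sepaff_ext (aPhi a b) => w; rewrite mxE.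
  exact: (mxsepaff_bordered a1 aq2 a2 aPsi i j k z t).
by apply: sepaff_ext (H i j) => z; rewrite mxE.
Qed.

Hypothesis q1_neq0 : q1 != 0.

Lemma bordered_multiaffine : multiaffine_fun (bordered q1 P1 Phi q2).
Proof.
exists Gp, q1; split; last exact: sepaff_multiaffine.
  by split=> // z _; rewrite /bordered GpE.
by move=> i j; apply: sepaff_multiaffine.
Qed.

Hypotheses (q1_real : forall z, pteval q1 (conjpt z) = (pteval q1 z)^*)
  (q2_real : forall z, pteval q2 (conjpt z) = (pteval q2 z)^*)
  (P1_herm : forall z, mxeval P1 (conjpt z) = (mxeval P1 z) ^t*).
Hypothesis stable : forall z t, (forall i, 0 < im (z ord0 i)) -> 0 < im t ->
  t * pteval q1 z + pteval q2 z != 0.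
Hypothesis pick : forall z t v, (forall i, 0 < im (z ord0 i)) -> 0 < im t ->
  0 <= im (hform v (t *: mxeval P1 z + mxeval P2 z) *
           (t * pteval q1 z + pteval q2 z)^*).

Lemma bordered_hermitian z : conjpt z = z -> (mxeval Gp z) ^t* = mxeval Gp z.
Proof.
move=> zR; rewrite GpE /Psi zR.
rewrite tr_block_mx map_block_mx -{1}P1_herm zR adj_adj; congr block_mx.
by rewrite tr_scalar_mx map_scalar_mx /= -q2_real zR.
Qed.

(** The inequality for P1 / q1 is the limit of that for f as t = i / y tends to
    infinity, and the one for q2 / q1 says that the root t of t q1 + q2 is not in
    the upper half-plane. Off the zeros of q1, g is Hermitian at real points. *)
Lemma bordered_IP : IP_class (bordered q1 P1 Phi q2).
Proof.
have nz : forall z, (forall i, 0 < im (z ord0 i)) -> pteval q1 z != 0.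
  apply: (stable_head_neq0 aq1 aq2 stable).
  apply: contrapT => /forallNP h; move/eqP: q1_neq0; apply; apply: pteval_eq0 => z.
  by have /negP := h z; rewrite negbK => /eqP.
have conj_fix z : (forall i, im (z ord0 i) = 0) -> conjpt z = z.
  by move=> zR; apply/rowP => i; rewrite mxE; apply: complex_ext; rewrite !cE // zR oppr0.
have bE : bordered q1 P1 Phi q2 = fun z => (pteval q1 z)^-1 *: mxeval Gp z.
  by apply/funext => z; rewrite GpE.
split; first split.
- move=> z zP; rewrite bE; apply: differentiable_mxeval_div.
  by apply: nz => i; rewrite -im_gt0; apply: zP.
- move=> z zP; apply/psd_imag => u.
  have {}zP i : 0 < im (z ord0 i) by rewrite -im_gt0; apply: zP.
  rewrite bE /= hformZ.
  have := im_mulJ (hform u (mxeval Gp z)) (nz z zP).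
  rewrite -(pmulr_rge0 _ (normsq_gt0 (nz z zP))) => <-; rewrite GpE.
  apply: (@bordered_form_ge0 R n m r (mxeval P1) (mxeval P2)
    (pteval q1) (pteval q2) (mxeval Phi) Psi).
  + by move=> a b; apply: sepaff_ext (aP1 a b) => w; rewrite mxE.
  + by move=> a b; apply: sepaff_ext (aP2 a b) => w; rewrite mxE.
  + exact: aq1.
  + exact: aq2.
  + by move=> a b; apply: sepaff_ext (aPhi a b) => w; rewrite mxE.
  + exact: aPsi.
  + by move=> w; rewrite -mxeval_wronskian W_sos.
  + exact: nz.
  + move=> w wP; rewrite leNgt; apply/negP => /im_root_gt0 t0.
    have := stable wP t0; rewrite divfK ?nz // addNr eqxx.
    by [].
  + move=> w v wP; set F1 := hform v (mxeval P1 w); set F2 := hform v (mxeval P2 w).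
    set a := pteval q1 w; set b := pteval q2 w.
    apply: (@quad_at0_ge0 _ _ (im ('i * F1 * b^*) + im (F2 * ('i * a)^*))
       (im (F2 * b^*))) => y y0 _.
    have t0 : 0 < im ('i * inC y^-1) by rewrite !cE mul0r add0r mul1r invr_gt0.
    have := pick v wP t0; rewrite -/a -/b.
    have -> : hform v ('i * inC y^-1 *: mxeval P1 w + mxeval P2 w) = 'i * inC y^-1 * F1 + F2.
      exact: hform_lin.
    move=> /(mulr_ge0 (sqr_ge0 y)) H; apply: le_trans H _.
    clearbody F1 F2 a b.
    rewrite le_eqVlt; apply/orP; left; apply/eqP; rewrite !cE.
    by field; rewrite gt_eqF.
  + move=> w wR; have wc := conj_fix w wR; split.
      by have := congr1 (@im R) (q1_real w); rewrite wc imJ; lra.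
    move=> v; rewrite -GpE; have := congr1 (@im R) (hform_adj v (mxeval Gp w)).
    by rewrite bordered_hermitian // imJ; lra.
  + by move=> i; apply: ltW.
- have [P' [q' [h _ _]]] := bordered_multiaffine; by exists P', q'.
- apply: null_set_sub (poly_zero_null aq1 q1_neq0) => x /= /negP nh.
  apply: contrapT => /eqP q1x; apply: nh; apply/hermsymmxE; rewrite bE /=.
  have xc : conjpt (real_pt x) = real_pt x.
    by apply: conj_fix => i; rewrite mxE.
  set c := (pteval q1 _)^-1.
  have cR : c^* = c.
    have -> : c^* = ((pteval q1 (real_pt x))^*)^-1 by exact: fmorphV.
    by rewrite -q1_real xc.
  rewrite -[in RHS](bordered_hermitian xc) -{2}cR.
  by apply/matrixP => i j; rewrite !mxE rmorphM.
Qed.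

End Bordered.

(** * Splitting off the first variable *)

Section Splitting.
Variable R : realType.
Local Notation C := (Cplx R).
Variable d : nat.
Implicit Types (z : 'rV[C]_d) (t : C).

Local Notation cons t z := (row_mx (t%:M : 'rV_1) z : 'rV[C]_(1 + d)).

Lemma cons0 t z i : cons t z ord0 (lshift d i) = t.
Proof. by rewrite row_mxEl (ord1 i) mxE eqxx. Qed.

Lemma cons_upd t z k s : cons t (upd z k s) = upd (cons t z) (rshift 1 k) s.
Proof.
apply/rowP => i; rewrite updE; case: (split_ordP i) => j ->.
  by rewrite !row_mxEl eq_lrshift.
by rewrite !row_mxEr updE (inj_eq (@rshift_inj _ _)).
Qed.

Lemma cons_conj t z : conjpt (cons t z) = cons t^* (conjpt z).
Proof.
apply/rowP => i; rewrite mxE; case: (split_ordP i) => j ->.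
  by rewrite !cons0.
by rewrite !row_mxEr mxE.
Qed.

Lemma cons_upper t z : 0 < im t -> (forall i, 0 < im (z ord0 i)) ->
  upper_half (cons t z).
Proof.
move=> t0 zP i; rewrite im_gt0; case: (split_ordP i) => j ->.
  by rewrite cons0.
by rewrite row_mxEr.
Qed.

Lemma sepaff_split (F : 'rV[C]_(1 + d) -> C) (F1 F2 : 'rV[C]_d -> C) :
  sepaff F -> (forall t z, F (cons t z) = t * F1 z + F2 z) -> sepaff F1 /\ sepaff F2.
Proof.
move=> aF FE.
have F2E z : F2 z = F (cons 0 z) by rewrite FE mul0r add0r.
have F1E z : F1 z = F (cons 1 z) - F (cons 0 z) by rewrite !FE mul1r mul0r add0r addrK.
have ac c : sepaff (fun z => F (cons c z)).
  by move=> k z t; rewrite !cons_upd; apply: aF.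
split; last by apply: sepaff_ext (ac 0) => z; rewrite F2E.
by apply: sepaff_ext (sepaffB (ac 1) (ac 0)) => z; rewrite F1E.
Qed.

Lemma conj_split (F G : 'rV[C]_(1 + d) -> C) (F1 F2 G1 G2 : 'rV[C]_d -> C) :
  (forall t z, F (cons t z) = t * F1 z + F2 z) ->
  (forall t z, G (cons t z) = t * G1 z + G2 z) ->
  (forall w : 'rV[C]_(1 + d), F (conjpt w) = (G w)^*) ->
  (forall z, F1 (conjpt z) = (G1 z)^*) /\ (forall z, F2 (conjpt z) = (G2 z)^*).
Proof.
move=> FE GE FG.
have h0 z : F2 (conjpt z) = (G2 z)^*.
  have := FG (cons 0 z).
  by rewrite cons_conj conjC0 FE GE !mul0r !add0r.
split=> // z; have := FG (cons 1 z).
rewrite cons_conj conjC1 FE GE !mul1r h0 => /eqP; rewrite -subr_eq0 => /eqP h.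
apply/eqP; rewrite -subr_eq0; apply/eqP; rewrite -[RHS]h.
by apply: complex_ext; rewrite !cE; ring.
Qed.

End Splitting.

Theorem theorem5p1 (R : realType) (d m r : nat)
  (f : 'rV[Cplx R]_(1 + d) -> 'M[Cplx R]_m)
  (P : 'M[mpoly (Cplx R) (1 + d)]_m) (q : mpoly (Cplx R) (1 + d))
  (P1 P2 : 'M[mpoly (Cplx R) d]_m) (q1 q2 : mpoly (Cplx R) d)
  (Phi0 : 'M[mpoly (Cplx R) d]_(m, r))
  (f_IP : IP_class f)
  (f_repr : represented_by f P q)
  (q_neq0 : forall z, upper_half z -> pteval q z != 0)
  (q_multiaffine : multiaffine q) (P_multiaffine : multiaffine_mx P)
  (q_real : real_coefs q) (P_herm : hermitian_coefs P)
  (q_split : forall (z0 : Cplx R) (z : 'rV[Cplx R]_d),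
     pteval q (row_mx z0%:M z) = z0 * pteval q1 z + pteval q2 z)
  (P_split : forall (z0 : Cplx R) (z : 'rV[Cplx R]_d),
     mxeval P (row_mx z0%:M z) = z0 *: mxeval P1 z + mxeval P2 z)
  (W_sos : is_sos_factor (wronskian P1 P2 q1 q2) Phi0) :
  (q1 != 0 ->
   let g := bordered q1 P1 Phi0 q2 in
   [/\ multiaffine_fun g, IP_class g &
     forall (z0 : Cplx R) (z : 'rV[Cplx R]_d),
       pteval q1 z != 0 -> pteval q (row_mx z0%:M z) != 0 ->
       drsubmx (g z) + z0%:M \in unitmx /\
       f (row_mx z0%:M z) =
         ulsubmx (g z) -
         ursubmx (g z) *m invmx (drsubmx (g z) + z0%:M) *m dlsubmx (g z)])
  /\
  (q2 != 0 ->
   let g := bordered q2 P2 Phi0 (- q1) in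
   [/\ multiaffine_fun g, IP_class g &
     forall (z0 : Cplx R) (z : 'rV[Cplx R]_d),
       z0 != 0 -> pteval q2 z != 0 -> pteval q (row_mx z0%:M z) != 0 ->
       drsubmx (g z) - (z0^-1)%:M \in unitmx /\
       f (row_mx z0%:M z) =
         ulsubmx (g z) -
         ursubmx (g z) *m invmx (drsubmx (g z) - (z0^-1)%:M) *m
           dlsubmx (g z)]).
Proof.
have PijE i j t z : pteval (P i j) (row_mx t%:M z) = t * pteval (P1 i j) z + pteval (P2 i j) z.
  by have /matrixP/(_ i j) := P_split t z; rewrite !mxE.
have [aq1 aq2] := sepaff_split (multiaffine_sepaff q_multiaffine) q_split.
have aP i j := sepaff_split (multiaffine_sepaff (P_multiaffine i j)) (PijE i j).
have aP1 i j : sepaff (pteval (P1 i j)) by case: (aP i j).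
have aP2 i j : sepaff (pteval (P2 i j)) by case: (aP i j).
have conj_eval n (p p' : mpoly (Cplx R) n) z : conjp p = p' ->
    pteval p (conjpt z) = (pteval p' z)^*.
  by move=> <-; rewrite pteval_conjp; symmetry; apply: conjCK.
have [q1_real q2_real] := conj_split q_split q_split
  (fun z => conj_eval _ _ _ z (real_coefs_conjp q_real)).
have Pc i j := conj_split (PijE i j) (PijE j i)
  (fun z => conj_eval _ _ _ z (hermitian_coefs_conjp i j P_herm)).
have P1_herm z : mxeval P1 (conjpt z) = (mxeval P1 z) ^t*.
  by apply/matrixP => i j; rewrite !mxE; case: (Pc i j).
have P2_herm z : mxeval P2 (conjpt z) = (mxeval P2 z) ^t*.
  by apply/matrixP => i j; rewrite !mxE; case: (Pc i j).
have stable (z : 'rV[Cplx R]_d) t : (forall i, 0 < im (z ord0 i)) -> 0 < im t ->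
    t * pteval q1 z + pteval q2 z != 0.
  by move=> zP t0; rewrite -q_split; apply: q_neq0; apply: cons_upper.
have pick (z : 'rV[Cplx R]_d) t v : (forall i, 0 < im (z ord0 i)) -> 0 < im t ->
    0 <= im (hform v (t *: mxeval P1 z + mxeval P2 z) *
             (t * pteval q1 z + pteval q2 z)^*).
  move=> zP t0; rewrite -q_split -P_split.
  have Zu := cons_upper t0 zP; have qZ := q_neq0 _ Zu.
  rewrite im_mulJ // pmulr_rge0 ?normsq_gt0 //.
  have [[_ h] _ _] := f_IP; have := (psd_imag _).1 (h _ Zu) v.
  by rewrite (f_repr.2 _ qZ) hformZ.
split=> [q1n0 g|q2n0 g].
  split.
  - exact: (bordered_multiaffine aP1 aP2 aq1 aq2 W_sos q1n0).
  - exact: (bordered_IP aP1 aP2 aq1 aq2 W_sos q1n0).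
  - move=> t z q1z qz; rewrite (f_repr.2 _ qz) P_split; rewrite q_split in qz *.
    exact: (bordered_schur W_sos).
have ptN n (p : mpoly (Cplx R) n) z : pteval (- p) z = - pteval p z by exact: mpoly.mevalN.
have aN (p : mpoly (Cplx R) d) : sepaff (pteval p) -> sepaff (pteval (- p)).
  by move=> ap; apply: sepaff_ext (sepaffZ (-1) ap) => z; rewrite ptN mulN1r.
have mxN z : mxeval (- P1) z = - mxeval P1 z.
  by apply/matrixP => i j; rewrite !mxE ptN.
have W_sos' : is_sos_factor (wronskian P2 (- P1) q2 (- q1)) Phi0.
  move=> z; apply: etrans (W_sos z).
  apply: etrans (mxeval_wronskian P2 (- P1) q2 (- q1) z) _.
  apply: etrans (esym (mxeval_wronskian P1 P2 q1 q2 z)).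
  by rewrite mxN (ptN d q1 z) scalerN opprK scaleNr addrC.
have aP1' i j : sepaff (pteval ((- P1) i j)) by rewrite mxE; apply: aN.
(* The substitution t -> - 1 / t exchanges the roles of head and tail. *)
have scal t (x y : Cplx R) : t != 0 -> t * x - y = t * (- t^-1 * y + x).
  by move=> t0; field.
have scalM t (A B : 'M[Cplx R]_m) : t != 0 -> t *: A - B = t *: (- t^-1 *: B + A).
  move=> t0; rewrite scalerDr scalerA mulrN divff // scaleN1r addrC.
  by [].
have root t : 0 < im t -> 0 < im (- t^-1) :> R.
  move=> t0; have := @im_root_gt0 R t 1; rewrite mulN1r; apply.
  by rewrite mul1r imJ oppr_lt0.
split.
- exact: (bordered_multiaffine aP2 aP1' aq2 (aN _ aq1) W_sos' q2n0).
- apply: (bordered_IP aP2 aP1' aq2 (aN _ aq1) W_sos' q2n0) => //.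
  + by move=> z; rewrite !ptN q1_real; apply: complex_ext; rewrite !cE.
  + move=> z t zP t0; have t1 : t != 0 by apply: contraTneq t0 => ->; rewrite im0 ltxx.
    by rewrite ptN scal // mulf_neq0 // stable // root.
  + move=> z t v zP t0; have t1 : t != 0 by apply: contraTneq t0 => ->; rewrite im0 ltxx.
    rewrite ptN mxN scal // scalM //.
    have scalF (A : 'M[Cplx R]_m) x : hform v (t *: A) * (t * x)^* =
        inC (re t ^+ 2 + im t ^+ 2) * (hform v A * x^*).
      rewrite hformZ; move: (hform v A) => a.
      by apply: complex_ext; rewrite !cE; ring.
    rewrite scalF imM im_inC mul0r addr0 re_inC mulr_ge0 //.
      exact: ltW (normsq_gt0 t1).
    by apply: pick => //; apply: root.
- move=> t z t0 q2z qz; rewrite (f_repr.2 _ qz) P_split; rewrite q_split in qz *.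
  have qz' : - t^-1 * pteval q2 z + pteval (- q1) z != 0.
    apply: contraNneq qz => h; rewrite ptN in h.
    have -> : t * pteval q1 z + pteval q2 z = - t * (- t^-1 * pteval q2 z - pteval q1 z).
      by field.
    by rewrite h mulr0.
  have := bordered_schur W_sos' q2z qz'; rewrite raddfN /= => -[u e]; split=> //.
  rewrite -e mxN ptN.
  have -> : t *: mxeval P1 z + mxeval P2 z = - t *: (- t^-1 *: mxeval P2 z - mxeval P1 z).
    by rewrite scalerBr scalerA mulrNN divff // scale1r scaleNr opprK addrC.
  have -> : t * pteval q1 z + pteval q2 z = - t * (- t^-1 * pteval q2 z - pteval q1 z).
    by field.
  by rewrite scalerA invfM mulrAC mulVf ?oppr_eq0 // mul1r.
Qed.
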